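(* Let $\gamma<0$ and define $$Z(f,t)=\frac{e^{-|\gamma|t}}{\sqrt{2|\gamma|}}\,B(f,e^{2|\gamma|t})\equiv e^{-|\gamma|t}\sqrt{\frac{c(f)}{2|\gamma|}}\,W(f,e^{2|\gamma|t}),\qquad t\in\mathbb{R},\ f\in 1_\pi^\perp .$$ Then $t\mapsto Z(\cdot,t)$ is a stationary random field such that, for any fixed $f_1,\dots,f_m\in 1_\pi^\perp$, $\{(Z(f_1,t),\dots,Z(f_m,t)):t\in\mathbb{R}\}$ is a stationary $m$-dimensional Ornstein–Uhlenbeck process with $\Gamma=\gamma\mathbf{I}$ and $C=-2A^{-1}$, i.e. with drift matrix $\gamma I_m$ and diffusion (noise covariance) matrix $\big(-2\langle f_i,A^{-1}f_j\rangle_\pi\big)_{1\le i,j\le m}$.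
   Context: Setting: $X=\{X(t):t\ge0\}$ is a progressively measurable Markov process on a measurable state space $(S,\mathcal{S})$, defined on a complete probability space, whose initial distribution is an ergodic invariant probability $\pi$. $L^2(S,\pi)$ is the real Hilbert space with inner product $\langle\cdot,\cdot\rangle_\pi$, and $1_\pi^\perp=\{f\in L^2(S,\pi):\int_S f\,d\pi=0\}$. Assumption on the generator: the transition semigroup of $X$ on $L^2(S,\pi)$ is strongly continuous, its infinitesimal generator $(A,\mathcal{D}(A))$ is densely defined and self-adjoint, its range is $\mathcal{R}(A)=1_\pi^\perp$, and $A^{-1}$ (the inverse of the bijection $A:\mathcal{D}(A)\cap 1_\pi^\perp\to 1_\pi^\perp$) is a bounded linear operator on $1_\pi^\perp$. Brownian field: $\{B(f,t):f\in 1_\pi^\perp,t\ge0\}$ is the space-time generalized Brownian motion (Brownian UGRF) with spatial covariance operator $C=-2A^{-1}$: a centered jointly Gaussian family, linear in $f$ (a.s.), such that for all $f_1,\dots,f_m\in 1_\pi^\perp$ the process $t\mapsto(B(f_1,t),\dots,B(f_m,t))$ is an $m$-dimensional Brownian motion started at $0$ and $\mathbb{E}B(f,s)B(g,t)=(s\wedge t)(-2\langle f,A^{-1}g\rangle_\pi)$. It arises as the limit in distribution of $n^{-1/2}\int_0^{nt}f(X_s)\,ds$. Write $c(f)=-2\langle f,A^{-1}f\rangle_\pi$ and, for each $f$, $B(f,\cdot)=\sqrt{c(f)}\,W(f,\cdot)$ with $W(f,\cdot)$ a one-dimensional standard Brownian motion. Ornstein–Uhlenbeck convention: an $m$-dimensional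 Ornstein–Uhlenbeck process with parameters $\Gamma$ (dissipative drift matrix) and $C$ (nonnegative symmetric matrix) is a process with the law of a solution of $dZ(t)=\Gamma Z(t)\,dt+\sqrt{C}\,dW(t)$, $W$ an $m$-dimensional standard Brownian motion; it is stationary if it is started from its centered Gaussian invariant distribution, which for $\Gamma=\gamma I_m$ has covariance matrix $-\tfrac12\Gamma^{-1}C$. *)

(* Defs.v *)
From HB Require Import structures.
From mathcomp Require Import all_boot all_order all_algebra.
From mathcomp Require Import all_classical all_reals all_analysis.
Set Implicit Arguments.
Unset Strict Implicit.
Unset Printing Implicit Defensive.
Import Order.TTheory GRing.Theory Num.Theory.
Import numFieldNormedType.Exports.
Local Open Scope classical_set_scope.
Local Open Scope ring_scope.

(** * Families of real random variables *)

Section families.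
Context {R : realType} {d : measure_display} {T : measurableType d}.
Variable P : probability T R.

(* The sigma-algebra generated by the variables Y i, i \in D. *)
Definition sigma_of (I : Type) (D : set I) (Y : I -> T -> R) : set (set T) :=
  <<s [set E | exists2 i, D i & exists2 U : set R, measurable U &
                 E = Y i @^-1` U] >>.

Definition independent_sigma (F G : set (set T)) : Prop :=
  forall A B, F A -> G B -> P (A `&` B) = (P A * P B)%E.

(* The case v = 0 is separate because the library's [normal_prob 0 0] is the
   uniform law on [0, 1] and not a point mass. *)
Definition centered_normal_law (v : R) (Y : T -> R) : Prop :=
  [/\ measurable_fun setT Y, 0 <= v &
      forall U : set R, measurable U ->
        P (Y @^-1` U) =
        if v == 0 then \d_(0 : R) U else normal_prob 0 (Num.sqrt v) U].

Definition centered_gaussian_vector (m : nat) (C : 'M[R]_m)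
    (Y : 'I_m -> T -> R) : Prop :=
  forall a : 'rV[R]_m, centered_normal_law ((a *m C *m a^T) ord0 ord0)
    (fun w => \sum_(i < m) a ord0 i * Y i w).

Definition centered_gaussian_family (I : Type) (D : set I) (Y : I -> T -> R)
    : Prop :=
  forall (n : nat) (a : 'I_n -> R) (k : 'I_n -> I), (forall j, D (k j)) ->
    exists v, centered_normal_law v (fun w => \sum_(j < n) a j * Y (k j) w).

Definition continuous_paths (m : nat) (D : set R) (Y : R -> 'I_m -> T -> R)
    : Prop :=
  {ae P, forall w, forall i, {within D, continuous (fun t => Y t i w)}}.

(* m-dimensional Brownian motion started at 0 with covariance matrix C, i.e.
   Cov (W t) = t C; it is standard when C is the identity. *)
Record brownian_motion (m : nat) (C : 'M[R]_m) (W : R -> 'I_m -> T -> R)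
    : Prop := {
  bm_measurable : forall t i, 0 <= t -> measurable_fun setT (W t i);
  bm_start : {ae P, forall w, forall i, W 0 i w = 0};
  bm_increment_law : forall s t, 0 <= s -> s <= t ->
    centered_gaussian_vector ((t - s) *: C) (fun i w => W t i w - W s i w);
  bm_increment_indep : forall s t, 0 <= s -> s <= t ->
    independent_sigma
      (sigma_of [set: 'I_m] (fun i w => W t i w - W s i w))
      (sigma_of [set k : R * 'I_m | 0 <= k.1 <= s] (fun k => W k.1 k.2));
  bm_continuous : continuous_paths `[0, +oo[ W
}.

Definition standard_brownian_motion (W : R -> T -> R) : Prop :=
  brownian_motion (1%:M : 'M[R]_1) (fun t _ => W t).

End families.

Arguments sigma_of {R d T I} D Y _.

(* Equality of all finite-dimensional distributions over the indices in D, of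
   two families possibly defined on different probability spaces. *)
Definition same_law (R : realType) (I : Type) (D : set I)
    (d : measure_display) (T : measurableType d) (P : probability T R)
    (Y : I -> T -> R)
    (d' : measure_display) (T' : measurableType d') (P' : probability T' R)
    (Y' : I -> T' -> R) : Prop :=
  forall (n : nat) (k : 'I_n -> I), (forall j, D (k j)) ->
  forall U : set (n.-tuple (measurableTypeR R)), measurable U ->
    P ((fun w => [tuple Y (k j) w | j < n]) @^-1` U) =
    P' ((fun w => [tuple Y' (k j) w | j < n]) @^-1` U).

(** * Ornstein-Uhlenbeck processes *)

Section ornstein_uhlenbeck.
Context {R : realType}.

Definition dissipative_mx (m : nat) (G : 'M[R]_m) : Prop :=
  forall x : 'cV[R]_m, x != 0 -> (x^T *m G *m x) ord0 ord0 < 0.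

Definition psd_mx (m : nat) (C : 'M[R]_m) : Prop :=
  C^T = C /\ forall x : 'cV[R]_m, 0 <= (x^T *m C *m x) ord0 ord0.

Definition is_sqrt_mx (m : nat) (C Q : 'M[R]_m) : Prop :=
  psd_mx Q /\ Q *m Q = C.

(* Y solves dY(t) = G Y(t) dt + sqrt(C) dW(t) on t >= 0, with Y(0) independent
   of the Brownian motion W. As the noise is additive, the equation is the
   pathwise integral equation. *)
Record ou_sde_solution (m : nat) (G C : 'M[R]_m) (d : measure_display)
    (T : measurableType d) (P : probability T R)
    (W Y : R -> 'I_m -> T -> R) : Prop := {
  ou_noise : brownian_motion P 1%:M W;
  ou_measurable : forall t i, 0 <= t -> measurable_fun setT (Y t i);
  ou_continuous : continuous_paths P `[0, +oo[ Y;
  ou_initial_indep : independent_sigma P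
    (sigma_of [set: 'I_m] (Y 0))
    (sigma_of [set k : R * 'I_m | 0 <= k.1] (fun k => W k.1 k.2));
  ou_equation : exists2 Q : 'M[R]_m, is_sqrt_mx C Q &
    {ae P, forall w, forall t i, 0 <= t ->
      Y t i w = Y 0 i w
        + \int[lebesgue_measure]_(s in `[0, t]) (\sum_(j < m) G i j * Y s j w)
        + \sum_(j < m) Q i j * W t j w}
}.

(* A process Z indexed by the whole real line is a stationary OU process with
   invariant law N(0, Sigma) when, from every starting time s, it has the law
   of a solution started from N(0, Sigma). Taking all s with the same solution
   Y makes Z stationary and N(0, Sigma) invariant for the equation. *)
Definition stationary_ou_process (m : nat) (G C Sigma : 'M[R]_m)
    (d : measure_display) (T : measurableType d) (P : probability T R)
    (Z : R -> 'I_m -> T -> R) : Prop :=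
  [/\ dissipative_mx G,
      psd_mx C,
      (forall t i, measurable_fun setT (Z t i)),
      continuous_paths P [set: R] Z &
      exists (d' : measure_display) (T' : measurableType d')
             (P' : probability T' R) (W Y : R -> 'I_m -> T' -> R),
        [/\ ou_sde_solution G C P' W Y,
            centered_gaussian_vector P' Sigma (Y 0) &
            forall s : R,
              same_law [set k : R * 'I_m | 0 <= k.1]
                P (fun k => Z (s + k.1) k.2) P' (fun k => Y k.1 k.2)]].

End ornstein_uhlenbeck.

(** * The Markov process and its generator *)

Section markov.
Context {R : realType} {dS : measure_display} {S : measurableType dS}.

Definition transition_function (p : R -> R.-pker S ~> S) : Prop :=
  (forall x (E : set S), measurable E -> p 0 x E = \d_x E) /\
  (forall s t x (E : set S), 0 <= s -> 0 <= t -> measurable E ->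
     p (s + t) x E = (\int[p s x]_y p t y E)%E).

Definition invariant_law (p : R -> R.-pker S ~> S) (pi : probability S R)
    : Prop :=
  forall t (E : set S), 0 <= t -> measurable E ->
    (\int[pi]_x p t x E)%E = pi E.

Definition ergodic_law (p : R -> R.-pker S ~> S) (pi : probability S R)
    : Prop :=
  forall E : set S, measurable E ->
    (forall t, 0 <= t -> {ae pi, forall x, p t x E = (\1_E x)%:E}) ->
    pi E = 0%E \/ pi E = 1%E.

Section process.
Context {d : measure_display} {T : measurableType d}.

Definition filtration (F : R -> set (set T)) : Prop :=
  [/\ forall t, 0 <= t -> sigma_algebra setT (F t),
      forall t, 0 <= t -> F t `<=` measurable &
      forall s t, 0 <= s -> s <= t -> F s `<=` F t].

(* For every t, (s, w) |-> X s w on [0, t] x T is measurable for the product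
   of the Borel sets of [0, t] and F t. *)
Definition progressively_measurable (F : R -> set (set T)) (X : R -> T -> S)
    : Prop :=
  forall t (E : set S), 0 <= t -> measurable E ->
    <<s `[0, t]%classic `*` [set: T],
        [set A | exists (U : set R) (V : set T),
           [/\ measurable U, U `<=` `[0, t]%classic, F t V & A = U `*` V]] >>
    [set q : R * T | q.1 \in `[0, t] /\ E (X q.1 q.2)].

Definition markov_property (P : probability T R) (F : R -> set (set T))
    (p : R -> R.-pker S ~> S) (X : R -> T -> S) : Prop :=
  forall s t (E : set S) (G : set T), 0 <= s -> 0 <= t -> measurable E ->
    F s G -> P (G `&` X (s + t) @^-1` E) = (\int[P]_(w in G) p t (X s w) E)%E.

Record ergodic_markov_process (P : probability T R) (F : R -> set (set T))
    (p : R -> R.-pker S ~> S) (pi : probability S R) (X : R -> T -> S)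
    : Prop := {
  mp_complete : measure_is_complete P;
  mp_filtration : filtration F;
  mp_progressive : progressively_measurable F X;
  mp_transition : transition_function p;
  mp_markov : markov_property P F p X;
  mp_initial : forall E : set S, measurable E -> P (X 0 @^-1` E) = pi E;
  mp_invariant : invariant_law p pi;
  mp_ergodic : ergodic_law p pi
}.

End process.

Section L2.
Variable pi : probability S R.

(* Representatives of the classes of L^2(S, pi): equality of elements of
   L^2(S, pi) is equality pi-a.e. below. *)
Definition L2 := LfunType pi (lee1n 2).

Definition L2norm (f : S -> R) : \bar R := ('N[pi]_2%:E[EFin \o f])%E.

Definition inner (f g : L2) : R := \int[pi]_x (f x * g x).

Definition one_perp : set L2 := [set f : L2 | \int[pi]_x (f x) = 0].

Variable p : R -> R.-pker S ~> S.

Definition semigroup (t : R) (f : S -> R) : S -> R :=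
  fun x => \int[p t x]_y (f y).

Definition strongly_continuous_semigroup : Prop :=
  forall f : L2, L2norm (fun x => semigroup t f x - f x) @[t --> 0^'+] --> 0%E.

(* The graph of the generator A: f \in D(A) and A f = g. *)
Definition generator (f g : L2) : Prop :=
  L2norm (fun x => (semigroup t f x - f x) / t - g x) @[t --> 0^'+] --> 0%E.

Definition densely_defined (A : L2 -> L2 -> Prop) : Prop :=
  forall (f : L2) (e : R), 0 < e ->
    exists h g : L2, A h g /\ (L2norm (fun x => f x - h x)%R < e%:E)%E.

(* The graph of the adjoint of the operator with graph A. *)
Definition adjoint (A : L2 -> L2 -> Prop) (g g' : L2) : Prop :=
  forall f h : L2, A f h -> inner h g = inner f g'.

Definition self_adjoint (A : L2 -> L2 -> Prop) : Prop :=
  forall g g' : L2, A g g' <-> adjoint A g g'.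

(* Ainv is the inverse of the bijection from D(A) \cap one_perp to one_perp
   given by A; its values outside one_perp are irrelevant. *)
Definition inverse_on_one_perp (A : L2 -> L2 -> Prop) (Ainv : L2 -> L2)
    : Prop :=
  (forall g, one_perp g -> one_perp (Ainv g)) /\
  (forall f g, one_perp f -> one_perp g ->
     (A f g <-> {ae pi, forall x, f x = Ainv g x})).

Definition bounded_linear_on_one_perp (Ainv : L2 -> L2) : Prop :=
  (forall (a : R) (f g : L2), one_perp f -> one_perp g ->
     {ae pi, forall x, Ainv (a *: f + g) x = a * Ainv f x + Ainv g x}) /\
  (exists M : R, forall f : L2, one_perp f ->
     (L2norm (Ainv f) <= M%:E * L2norm f)%E).

Record generator_assumption (Ainv : L2 -> L2) : Prop := {
  ga_strongly_continuous : strongly_continuous_semigroup;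
  ga_dense : densely_defined generator;
  ga_self_adjoint : self_adjoint generator;
  ga_range : forall g : L2, (exists f : L2, generator f g) <-> one_perp g;
  ga_inverse : inverse_on_one_perp generator Ainv;
  ga_bounded : bounded_linear_on_one_perp Ainv
}.

End L2.
End markov.

(** * The Brownian field and its Ornstein-Uhlenbeck transform *)

Section fields.
Context {R : realType} {dS : measure_display} {S : measurableType dS}.
Variables (pi : probability S R) (Ainv : L2 pi -> L2 pi).

Definition cov_form (f g : L2 pi) : R := - 2 * inner f (Ainv g).

Definition cov_mx (m : nat) (f : 'I_m -> L2 pi) : 'M[R]_m :=
  \matrix_(i, j) cov_form (f i) (f j).

Context {d : measure_display} {T : measurableType d}.
Variable P : probability T R.

Record brownian_field (B : L2 pi -> R -> T -> R) : Prop := {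
  bf_gaussian : centered_gaussian_family P
    [set k : L2 pi * R | one_perp k.1 /\ 0 <= k.2] (fun k => B k.1 k.2);
  bf_linear : forall (a : R) (f g : L2 pi) t, one_perp f -> one_perp g ->
    0 <= t -> {ae P, forall w, B (a *: f + g) t w = a * B f t w + B g t w};
  bf_brownian : forall (m : nat) (f : 'I_m -> L2 pi),
    (forall i, one_perp (f i)) ->
    brownian_motion P (cov_mx f) (fun t i => B (f i) t);
  bf_covariance : forall (f g : L2 pi) s t, one_perp f -> one_perp g ->
    0 <= s -> 0 <= t ->
    ('E_P[fun w => (B f s w * B g t w)%R] = (Num.min s t * cov_form f g)%:E)%E
}.

Definition brownian_normalization (B W : L2 pi -> R -> T -> R) : Prop :=
  forall f : L2 pi, one_perp f ->
    standard_brownian_motion P (W f) /\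
    {ae P, forall w, forall t, 0 <= t ->
       B f t w = Num.sqrt (cov_form f f) * W f t w}.

Definition ou_field (gamma : R) (B : L2 pi -> R -> T -> R)
    (f : L2 pi) (t : R) (w : T) : R :=
  expR (- (`|gamma| * t)) / Num.sqrt (2 * `|gamma|)
    * B f (expR (2 * `|gamma| * t)) w.

(* t |-> Z(., t) is a stationary process of random linear functionals on
   one_perp. *)
Record stationary_random_field (Z : L2 pi -> R -> T -> R) : Prop := {
  rf_measurable : forall f t, one_perp f -> measurable_fun setT (Z f t);
  rf_linear : forall (a : R) (f g : L2 pi) t, one_perp f -> one_perp g ->
    {ae P, forall w, Z (a *: f + g) t w = a * Z f t w + Z g t w};
  rf_stationary : forall h : R,
    same_law [set k : L2 pi * R | one_perp k.1]
      P (fun k => Z k.1 (k.2 + h)) P (fun k => Z k.1 k.2)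
}.

End fields.

(* Main.v *)
(* A joint law is determined by the laws of linear combinations (Cramer-Wold),
   so centered Gaussian families with the same covariance kernel have the same
   finite-dimensional distributions, and vanishing cross-covariance means
   independence.  Since B(f_i, .) is a Brownian motion with covariance matrix C,
   Z is Gaussian with covariance exp(- |gamma| |t - u|) C / (2 |gamma|), which
   depends on t - u only.

   On a product space carrying an independent standard Brownian motion W, put
   x = sqrt(C) W and
     y(t) = exp(- |gamma| t) (Z(0) - |gamma| int_0^t exp(|gamma| r) x(r) dr) + x(t).
   This solves the equation pathwise.  It is a limit of linear combinations of
   independent Gaussian increments, hence Gaussian, with the same covariance as
   Z(s + .) for every s.

   No formula for the normal density or its characteristic function is used:
   the standard Brownian motion W(0, .) supplied by the hypotheses serves as a
   reference whose marginal at time v has law N(0, v), so sums of independent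
   normal variables and limits of normal variables are compared with its
   increments and with its path. *)
Require Import Defs.
From mathcomp Require Import all_boot all_order all_algebra.
From mathcomp Require Import all_classical all_reals all_analysis.
From mathcomp Require Import measurable_realfun ring lra complex.
Import Order.TTheory GRing.Theory Num.Theory.
Import numFieldNormedType.Exports.
Local Open Scope classical_set_scope.
Local Open Scope ring_scope.
Set Implicit Arguments.
Unset Strict Implicit.
Unset Printing Implicit Defensive.

(** * Laws determined by the means of trigonometric polynomials *)

Section bounded_expectation.
Context d (T : measurableType d) (R : realType) (P : probability T R).
Implicit Types X V : T -> R.

Lemma bounded_integrable X B : measurable_fun setT X ->
  (forall w, `|X w| <= B) -> P.-integrable setT (EFin \o X).
Proof.
move=> mX XB; apply: measurable_bounded_integrable => //.
  by rewrite -ge0_fin_numE// fin_num_measure.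
by exists B; split => [|M BM w _ /=]; [rewrite num_real|exact: le_trans (XB w) (ltW BM)].
Qed.

Lemma cvg_bounded_expectation (X_ : nat -> T -> R) X B :
  (forall n, measurable_fun setT (X_ n)) -> measurable_fun setT X ->
  {ae P, forall w, X_ ^~ w @ \oo --> X w} ->
  (forall n w, `|X_ n w| <= B) ->
  \int[P]_w X_ n w @[n --> \oo] --> \int[P]_w X w.
Proof.
move=> mX_ mX XX XB.
have iB : P.-integrable setT (EFin \o cst B).
  exact: finite_measure_integrable_cst.
have [||||iX _ cX] := @dominated_convergence _ T R P setT measurableT
  (fun n => EFin \o X_ n) (EFin \o X) (EFin \o cst B) _ _ _ iB _.
- by move=> n; exact/measurable_EFinP.
- exact/measurable_EFinP.
- apply: filterS XX => w XXw _; apply: cvg_EFin => //.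
  by apply: nearW => n.
- by apply: aeW => w n _; rewrite lee_fin.
apply: fine_cvg; rewrite fineK//.
exact: integrable_fin_num.
Qed.

End bounded_expectation.

Section same_mean.
Context (R : realType) d (T : measurableType d) (P : probability T R)
  d' (T' : measurableType d') (P' : probability T' R).
Implicit Types M : (T -> R) -> (T' -> R) -> Prop.

Record same_mean_algebra M : Prop := {
  sma_cst : forall c, M (fun=> c) (fun=> c);
  sma_add : forall X X' V V', M X X' -> M V V' ->
    M (fun w => X w + V w) (fun w => X' w + V' w);
  sma_mul : forall X X' V V', M X X' -> M V V' ->
    M (fun w => X w * V w) (fun w => X' w * V' w);
  sma_meas : forall X X', M X X' ->
    measurable_fun setT X /\ measurable_fun setT X';
  sma_bounded : forall X X', M X X' ->
    exists B, (forall w, `|X w| <= B) /\ (forall w, `|X' w| <= B);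
  sma_mean : forall X X', M X X' -> \int[P]_w X w = \int[P']_w X' w
}.

(* Applied twice to the trigonometric polynomials in the coordinates, this
   closure reaches the indicators of half-lines. *)
Definition bounded_limits M (X : T -> R) (X' : T' -> R) : Prop :=
  exists (X_ : nat -> T -> R) (X'_ : nat -> T' -> R) (B : R),
  [/\ forall n, M (X_ n) (X'_ n),
      forall n, (forall w, `|X_ n w| <= B) /\ (forall w, `|X'_ n w| <= B),
      forall w, X_ ^~ w @ \oo --> X w &
      forall w, X'_ ^~ w @ \oo --> X' w].

Lemma bounded_limit_meas M X X' : same_mean_algebra M -> bounded_limits M X X' ->
  measurable_fun setT X /\ measurable_fun setT X'.
Proof.
move=> aM [X_ [X'_ [B [MX _ XX XX']]]]; split.
  apply: (measurable_fun_cvg (h := X_)) => [n|w _]; last exact: XX.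
  exact: (sma_meas aM (MX n)).1.
apply: (measurable_fun_cvg (h := X'_)) => [n|w _]; last exact: XX'.
exact: (sma_meas aM (MX n)).2.
Qed.

Lemma same_mean_bounded_limits M :
  same_mean_algebra M -> same_mean_algebra (bounded_limits M).
Proof.
move=> aM; split.
- move=> c; exists (fun _ _ => c), (fun _ _ => c), `|c|.
  by split => // [n|w|w]; [exact: sma_cst|exact: cvg_cst|exact: cvg_cst].
- move=> X X' V V' [X_ [X'_ [B [MX bX XX XX']]]] [V_ [V'_ [C [MV bV VV VV']]]].
  exists (fun n w => X_ n w + V_ n w), (fun n w => X'_ n w + V'_ n w), (B + C).
  split => [n|n|w|w]; [exact: sma_add| |exact: cvgD|exact: cvgD].
  split=> w; apply: le_trans (ler_normD _ _) _; apply: lerD.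
  + exact: (bX n).1.
  + exact: (bV n).1.
  + exact: (bX n).2.
  + exact: (bV n).2.
- move=> X X' V V' [X_ [X'_ [B [MX bX XX XX']]]] [V_ [V'_ [C [MV bV VV VV']]]].
  exists (fun n w => X_ n w * V_ n w), (fun n w => X'_ n w * V'_ n w), (B * C).
  split => [n|n|w|w]; [exact: sma_mul| |exact: cvgM|exact: cvgM].
  split=> w; rewrite normrM; apply: ler_pM => //.
  + exact: (bX n).1.
  + exact: (bV n).1.
  + exact: (bX n).2.
  + exact: (bV n).2.
- by move=> X X'; exact: bounded_limit_meas.
- move=> X X' [X_ [X'_ [B [MX bX XX XX']]]]; exists B; split => w.
  + apply: (ler_cvg_to (cvg_norm (XX w)) (cvg_cst B)); apply: nearW => n.
    exact: (bX n).1.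
  + apply: (ler_cvg_to (cvg_norm (XX' w)) (cvg_cst B)); apply: nearW => n.
    exact: (bX n).2.
- move=> X X' lX; have [mX mX'] := bounded_limit_meas aM lX.
  move: lX => [X_ [X'_ [B [MX bX XX XX']]]].
  have cX := cvg_bounded_expectation (fun n => (sma_meas aM (MX n)).1) mX
    (aeW P XX) (fun n => (bX n).1).
  have cX' := cvg_bounded_expectation (fun n => (sma_meas aM (MX n)).2) mX'
    (aeW P' XX') (fun n => (bX n).2).
  apply: (cvg_unique _ cX) => //; apply: cvg_trans cX'; apply: near_eq_cvg.
  by apply: nearW => n; rewrite (sma_mean aM (MX n)).
Qed.

Lemma sma_exp M X X' n : same_mean_algebra M -> M X X' ->
  M (fun w => X w ^+ n) (fun w => X' w ^+ n).
Proof.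
move=> aM MX; elim: n => [|n IHn]; first exact: sma_cst.
under eq_fun do rewrite exprS.
under [X in M _ X]eq_fun do rewrite exprS.
exact: sma_mul.
Qed.

Lemma sma_sub M X X' V V' : same_mean_algebra M -> M X X' -> M V V' ->
  M (fun w => X w - V w) (fun w => X' w - V' w).
Proof.
move=> aM MX MV.
under eq_fun do rewrite -mulN1r.
under [X in M _ X]eq_fun do rewrite -mulN1r.
by apply: sma_add => //; apply: sma_mul => //; exact: sma_cst.
Qed.

Lemma sma_prod M (I : Type) (s : seq I) (X : I -> T -> R) (X' : I -> T' -> R) :
  same_mean_algebra M -> (forall i, M (X i) (X' i)) ->
  M (fun w => \prod_(i <- s) X i w) (fun w => \prod_(i <- s) X' i w).
Proof.
move=> aM MX; elim: s => [|i s IHs].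
  under eq_fun do rewrite big_nil.
  under [X in M _ X]eq_fun do rewrite big_nil.
  exact: sma_cst.
under eq_fun do rewrite big_cons.
under [X in M _ X]eq_fun do rewrite big_cons.
exact: sma_mul.
Qed.

End same_mean.

Section step.
Context (R : realType).

Lemma natr_mul_expr_le (r : R) n : 0 <= r < 1 -> n%:R * r ^+ n * (1 - r) <= 1.
Proof.
move=> /andP[r0 r1]; apply: (@le_trans _ _ (1 - r ^+ n)); last first.
  by rewrite gerBl exprn_ge0.
elim: n => [|n IHn]; first by rewrite mul0r mul0r subrr.
have H : r * (n%:R * r ^+ n * (1 - r)) <= r * (1 - r ^+ n) by exact: ler_wpM2l.
have H2 : 0 <= (1 - r) * (1 - r * r ^+ n).
  rewrite mulr_ge0 ?subr_ge0 ?(ltW r1)// -exprS.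
  by rewrite exprn_ile1 // ltW.
rewrite -natr1 exprS; move: H H2; set a := r ^+ n; set b : R := n%:R.
move=> H H2.
have -> : (b + 1) * (r * a) * (1 - r) = r * (b * a * (1 - r)) + r * a * (1 - r).
  by ring.
apply: le_trans (lerD H (lexx _)) _; rewrite -subr_ge0.
by apply: le_trans H2 _; rewrite le_eqVlt; apply/orP; left; apply/eqP; ring.
Qed.

Lemma exprn_1B_ge (x : R) n : 0 <= x <= 1 -> 1 - n%:R * x <= (1 - x) ^+ n.
Proof.
move=> /andP[x0 x1]; elim: n => [|n IHn]; first by rewrite mul0r subr0 expr0.
have H : (1 - x) * (1 - n%:R * x) <= (1 - x) * (1 - x) ^+ n.
  by rewrite ler_wpM2l// subr_ge0.
rewrite exprS; apply: le_trans H; rewrite -natr1 -subr_ge0.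
have -> : (1 - x) * (1 - n%:R * x) - (1 - (n%:R + 1) * x) = n%:R * x * x by ring.
by rewrite !mulr_ge0.
Qed.

(* Without the factor [n] in the exponent, the limit at the threshold would be
   [expR (-1)]. *)
Lemma cvg_step (u : R) : 0 <= u <= 1 ->
  (1 - u ^+ n) ^+ (n * 2 ^ n) @[n --> \oo] --> ((u < 2^-1)%R%:R : R).
Proof.
move=> /andP[u0 u1].
have un n : 0 <= u ^+ n <= 1 by rewrite exprn_ge0// exprn_ile1.
have un' n : 0 <= 1 - u ^+ n <= 1.
  by have /andP[? ?] := un n; rewrite subr_ge0 gerBl; apply/andP.
case: ltP => u2 /=.
- have r0 : 0 <= 2 * u by rewrite mulr_ge0.
  have r1 : 2 * u < 1 by lra.
  pose s := Num.sqrt (2 * u).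
  have s0 : 0 <= s by rewrite sqrtr_ge0.
  have s1 : s < 1 by rewrite -sqrtr1 ltr_sqrt.
  have sE : s * s = 2 * u by rewrite -expr2 sqr_sqrtr.
  apply: (@squeeze_cvgr _ _ _ _ (fun n => 1 - s ^+ n * (1 - s)^-1) (fun=> 1)).
  + apply: nearW => n; apply/andP; split; last first.
      by have /andP[? ?] := un' n; exact: exprn_ile1.
    apply: le_trans (exprn_1B_ge _ (un n)); rewrite lerD2l lerN2 natrM natrX.
    rewrite -mulrA -exprMn -sE exprMn mulrA mulrC ler_wpM2l ?exprn_ge0//.
    by rewrite -[leRHS]mul1r ler_pdivlMr ?subr_gt0 ?natr_mul_expr_le // s0.
  + rewrite -[X in _ --> X]subr0; apply: cvgB; first exact: cvg_cst.
    rewrite -[X in _ --> X](mul0r (1 - s)^-1); apply: cvgM; last exact: cvg_cst.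
    by apply: cvg_expr; rewrite ger0_norm.
  + exact: cvg_cst.
- apply: (@squeeze_cvgr _ _ _ _ (fun=> 0) (fun n => expR (- n%:R))).
  + apply: nearW => n; have /andP[q0 q1] := un' n; rewrite exprn_ge0//=.
    have h : 1 - u ^+ n <= expR (- (2^-1) ^+ n).
      apply: le_trans (expR_ge1Dx _); rewrite lerD2l lerN2.
      by apply: lerXn2r; rewrite // nnegrE.
    have e0 : 0 <= expR (- (2^-1) ^+ n) :> R by exact: expR_ge0.
    apply: le_trans (lerXn2r _ _ _ h) _; rewrite ?nnegrE//.
    by rewrite -expRM_natr natrM natrX mulNr mulrCA -exprMn mulVf// expr1n mulr1.
  + exact: cvg_cst.
  + exact: cvgn_expR.
Qed.

End step.

Lemma measurable_cos_affine (R : realType) (b : R) :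
  measurable_fun setT (fun x : R => cos (x + b)).
Proof.
apply: continuous_measurable_fun => x; apply: continuous_comp.
  by apply: cvgD; [exact: cvg_id|exact: cvg_cst].
exact: continuous_cos.
Qed.

Section cramer_wold.
Context (R : realType) d (T : measurableType d) (P : probability T R)
  d' (T' : measurableType d') (P' : probability T' R).

Lemma eq_bounded_expectation_law (X : T -> R) (X' : T' -> R) (f : R -> R) B :
  measurable_fun setT X -> measurable_fun setT X' ->
  (forall U : set R, measurable U -> P (X @^-1` U) = P' (X' @^-1` U)) ->
  measurable_fun setT f -> (forall x, `|f x| <= B) ->
  \int[P]_w f (X w) = \int[P']_w f (X' w).
Proof.
move=> mX mX' XX' mf fB; rewrite /Rintegral; congr fine.
have mF : measurable_fun setT (EFin \o f) by exact/measurable_EFinP.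
have iX : P.-integrable setT ((EFin \o f) \o X).
  apply: (@bounded_integrable _ _ _ P (f \o X) B) => [|w]; last exact: fB.
  exact: measurableT_comp.
have iX' : P'.-integrable setT ((EFin \o f) \o X').
  apply: (@bounded_integrable _ _ _ P' (f \o X') B) => [|w]; last exact: fB.
  exact: measurableT_comp.
have := integral_pushforward mX mF iX measurableT.
have := integral_pushforward mX' mF iX' measurableT.
rewrite !preimage_setT => <- <-.
by apply: eq_measure_integral => A mA _; exact: XX'.
Qed.

Variables (n : nat) (Y : 'I_n -> T -> R) (Y' : 'I_n -> T' -> R).
Hypothesis mY : forall i, measurable_fun setT (Y i).
Hypothesis mY' : forall i, measurable_fun setT (Y' i).
Hypothesis cosY : forall (a : 'I_n -> R) (b : R),
  \int[P]_w cos (\sum_i a i * Y i w + b) =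
  \int[P']_w cos (\sum_i a i * Y' i w + b).

Let mS d1 (T1 : measurableType d1) (Z : 'I_n -> T1 -> R) (a : 'I_n -> R) :
  (forall i, measurable_fun setT (Z i)) ->
  measurable_fun setT (fun w => \sum_i a i * Z i w).
Proof. by move=> mZ; apply: measurable_sum => i; exact: measurable_funM. Qed.

Let trig_value (y : 'I_n -> R) (p : R * ('I_n -> R) * R) :=
  p.1.1 * cos (\sum_i p.1.2 i * y i + p.2).

Let trig (X : T -> R) (X' : T' -> R) := exists s : seq (R * ('I_n -> R) * R),
  X = (fun w => \sum_(p <- s) trig_value (Y ^~ w) p) /\
  X' = (fun w => \sum_(p <- s) trig_value (Y' ^~ w) p).

Let trig_mul (p q : R * ('I_n -> R) * R) : seq (R * ('I_n -> R) * R) :=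
  [:: (p.1.1 * q.1.1 / 2, fun i => p.1.2 i + q.1.2 i, p.2 + q.2);
      (p.1.1 * q.1.1 / 2, fun i => p.1.2 i - q.1.2 i, p.2 - q.2)].

Let trig_mulE y p q :
  \sum_(r <- trig_mul p q) trig_value y r = trig_value y p * trig_value y q.
Proof.
rewrite /trig_mul big_cons big_seq1 /trig_value /=.
under eq_bigr do rewrite mulrDl.
under [X in _ + _ * cos (X + _)]eq_bigr do rewrite mulrBl.
rewrite big_split/= sumrB.
set A := \sum_i _; set B := \sum_i _.
rewrite (_ : A + B + _ = (A + p.2) + (B + q.2)); last by ring.
rewrite (_ : A - B + _ = (A + p.2) - (B + q.2)); last by ring.
by rewrite cosD cosB; field.
Qed.

Let trig_algebra : same_mean_algebra P P' trig.
Proof.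
have trig_meas d1 (T1 : measurableType d1) (Z : 'I_n -> T1 -> R) s :
    (forall i, measurable_fun setT (Z i)) ->
    measurable_fun setT (fun w => \sum_(p <- s) trig_value (Z ^~ w) p).
  move=> mZ; apply: measurable_sum => p; apply: measurable_funM => //.
  exact: (measurableT_comp (measurable_cos_affine p.2) (mS _ mZ)).
have trig_bound y s :
    `|\sum_(p <- s) trig_value y p| <= \sum_(p <- s) `|p.1.1|.
  apply: le_trans (ler_norm_sum _ _ _) _; apply: ler_sum => p _.
  by rewrite normrM ler_piMr// cos_max.
split.
- move=> c; exists [:: (c, fun=> 0, 0)].
  by split; apply/funext => w; rewrite big_seq1 /trig_value/= big1 ?add0r
    ?cos0 ?mulr1// => i _; rewrite mul0r.
- move=> X X' V V' [s [-> ->]] [r [-> ->]]; exists (s ++ r).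
  by split; apply/funext => w; rewrite big_cat.
- move=> X X' V V' [s [-> ->]] [r [-> ->]].
  exists (flatten [seq flatten [seq trig_mul p q | q <- r] | p <- s]).
  by split; apply/funext => w; rewrite big_distrl big_flatten big_map;
    apply: eq_bigr => p _; rewrite big_distrr big_flatten big_map;
    apply: eq_bigr => q _; rewrite trig_mulE.
- by move=> X X' [s [-> ->]]; split; exact: trig_meas.
- move=> X X' [s [-> ->]]; exists (\sum_(p <- s) `|p.1.1|).
  by split => w; exact: trig_bound.
- move=> X X' [s [-> ->]].
  elim: s => [|p s IHs].
    under eq_Rintegral do rewrite big_nil.
    under [RHS]eq_Rintegral do rewrite big_nil.
    by rewrite !Rintegral_cst//= !mul0r.
  under eq_Rintegral do rewrite big_cons.
  under [RHS]eq_Rintegral do rewrite big_cons.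
  have int d1 (T1 : measurableType d1) (P1 : probability T1 R)
      (Z : 'I_n -> T1 -> R) s1 : (forall i, measurable_fun setT (Z i)) ->
      P1.-integrable setT (EFin \o (fun w => \sum_(p <- s1) trig_value (Z ^~ w) p)).
    by move=> mZ; apply: bounded_integrable => [|w]; [exact: trig_meas|exact: trig_bound].
  have int1 d1 (T1 : measurableType d1) (P1 : probability T1 R)
      (Z : 'I_n -> T1 -> R) : (forall i, measurable_fun setT (Z i)) ->
      P1.-integrable setT (EFin \o (fun w => trig_value (Z ^~ w) p)).
    move=> mZ; have := int _ _ P1 Z [:: p] mZ.
    by under eq_fun do rewrite big_seq1.
  rewrite RintegralD//; [|exact: int1|exact: int].
  rewrite RintegralD//; [|exact: int1|exact: int].
  congr (_ + _); last exact: IHs.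
  rewrite /trig_value !RintegralZl//; first by rewrite cosY.
  + apply: (@bounded_integrable _ _ _ P' _ 1) => [|w]; last exact: cos_max.
    exact: (measurableT_comp (measurable_cos_affine p.2) (mS _ mY')).
  + apply: (@bounded_integrable _ _ _ P _ 1) => [|w]; last exact: cos_max.
    exact: (measurableT_comp (measurable_cos_affine p.2) (mS _ mY)).
Qed.

Let sin_step (c y : R) (N : nat) : R :=
  (sin ((y - c) / N.+1%:R) > 0)%R%:R.

Let trig_sin_step i c N : bounded_limits trig
  (fun w => sin_step c (Y i w) N) (fun w => sin_step c (Y' i w) N).
Proof.
pose u x : R := (1 - sin ((x - c) / N.+1%:R)) / 2.
have u01 x : 0 <= u x <= 1.
  have := sin_le1 ((x - c) / N.+1%:R); have := sin_geN1 ((x - c) / N.+1%:R).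
  by rewrite /u => *; lra.
have trig_u : trig (fun w => u (Y i w)) (fun w => u (Y' i w)).
  have trig_sin : trig (fun w => sin ((Y i w - c) / N.+1%:R))
      (fun w => sin ((Y' i w - c) / N.+1%:R)).
    exists [:: (1, fun j => N.+1%:R^-1 *+ (j == i), - c / N.+1%:R - pi / 2)].
    by split; apply/funext => w; rewrite big_seq1 /trig_value/= mul1r (bigD1 i)//=
      eqxx big1 => [|j /negPf ->]; rewrite ?mul0r// -cosBpihalf mulr1n addr0;
      congr cos; rewrite mulrDl (mulrC (_^-1)) addrA.
  have trig_half := sma_cst trig_algebra 2^-1.
  have trig_one := sma_cst trig_algebra 1.
  exact: (sma_mul trig_algebra (sma_sub trig_algebra trig_one trig_sin) trig_half).
have step_E x : (u x < 2^-1) = (0 < sin ((x - c) / N.+1%:R)).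
  by rewrite /u; apply/idP/idP => *; lra.
exists (fun k w => (1 - u (Y i w) ^+ k) ^+ (k * 2 ^ k)),
  (fun k w => (1 - u (Y' i w) ^+ k) ^+ (k * 2 ^ k)), 1.
have bound k x : `|(1 - u x ^+ k) ^+ (k * 2 ^ k)| <= 1.
  have /andP[u0 u1] := u01 x.
  rewrite normrX exprn_ile1// ger0_norm ?subr_ge0 ?gerBl ?exprn_ge0//.
  exact: exprn_ile1.
split => [k|k|w|w].
- have aT := trig_algebra.
  exact: (sma_exp _ aT (sma_sub aT (sma_cst aT 1) (sma_exp k aT trig_u))).
- by split=> w; exact: bound.
- by rewrite /sin_step -step_E; exact: cvg_step.
- by rewrite /sin_step -step_E; exact: cvg_step.
Qed.

Let cvg_sin_step c y : sin_step c y N @[N --> \oo] --> ((c < y)%R%:R : R).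
Proof.
have [N0 HN0] : exists N0 : nat, `|y - c| < N0%:R.
  by exists (Num.truncn `|y - c|).+1; exact: truncnS_gt.
apply: cvg_near_cst; exists N0 => // N /= NN0.
have N1 : (0 : R) < N.+1%:R by rewrite ltr0n.
have lt1 : `|y - c| / N.+1%:R < 1.
  by rewrite ltr_pdivrMr// mul1r (lt_le_trans HN0)// ler_nat leqW.
rewrite /sin_step; congr (nat_of_bool _)%:R; have [cy|yc] := ltP c y.
- rewrite sin2_gt0// divr_gt0 ?subr_gt0//=.
  by move: lt1; rewrite gtr0_norm ?subr_gt0// => /lt_trans; apply; rewrite ltr1n.
- apply/negbTE; rewrite -leNgt -opprB mulNr sinN oppr_le0.
  move: lt1; rewrite ler0_norm ?subr_le0// opprB => lt1.
  have [->|yc'] := eqVneq y c; first by rewrite subrr mul0r sin0.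
  apply/ltW/sin2_gt0/andP; split.
    by rewrite divr_gt0 ?ltr0n// subr_gt0 lt_neqAle yc' yc.
  by apply: lt_trans lt1 _; rewrite ltr1n.
Qed.

Let trig_indic i c : bounded_limits (bounded_limits trig)
  (fun w => (c < Y i w)%R%:R) (fun w => (c < Y' i w)%R%:R).
Proof.
exists (fun N w => sin_step c (Y i w) N), (fun N w => sin_step c (Y' i w) N), 1.
split => [N|N|w|w]; [exact: trig_sin_step| |exact: cvg_sin_step|exact: cvg_sin_step].
by split => w; rewrite /sin_step; case: (_ < _); rewrite ?normr0 ?normr1.
Qed.

Let orthant_prob (c : 'I_n -> R) :
  P [set w | forall i, c i < Y i w] = P' [set w | forall i, c i < Y' i w].
Proof.
have aM := same_mean_bounded_limits (same_mean_bounded_limits trig_algebra).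
have := sma_mean aM (sma_prod (index_enum 'I_n) aM (fun i => trig_indic i (c i))).
have orthant_mean d1 (T1 : measurableType d1) (P1 : probability T1 R)
    (Z : 'I_n -> T1 -> R) : (forall i, measurable_fun setT (Z i)) ->
    (\int[P1]_w \prod_i (c i < Z i w)%R%:R)%:E = P1 [set w | forall i, c i < Z i w].
  move=> mZ.
  have mO : measurable [set w | forall i, c i < Z i w].
    rewrite (_ : [set _ | _] = \bigcap_(i in [set: 'I_n]) (Z i @^-1` `]c i, +oo[)).
      apply: fin_bigcap_measurable => // i _.
      by rewrite -[X in measurable X]setTI; apply: mZ.
    apply/seteqP; split => w /= cZ i; first by rewrite /= in_itv/= cZ.
    by have := cZ i I; rewrite /= in_itv/= andbT.
  rewrite (_ : (fun w => _) = \1_[set w | forall i, c i < Z i w]).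
    rewrite /Rintegral integral_indic// setIT fineK//.
    exact: fin_num_measure.
  apply/funext => w; rewrite indicE.
  have [/set_mem/= cZ|/negP cZ] := boolP (w \in _).
    by rewrite big1// => i _; rewrite cZ.
  have /existsNP[i /negP/negPf cZi] : ~ forall i, c i < Z i w.
    by move=> cZ'; apply: cZ; rewrite inE.
  by rewrite (bigD1 i)//= cZi mul0r.
by rewrite -!orthant_mean// => ->.
Qed.

Let tupleY d1 (T1 : measurableType d1) (Z : 'I_n -> T1 -> R) (w : T1) :
  n.-tuple (measurableTypeR R) := [tuple Z j w | j < n].

Let coord i (t : n.-tuple (measurableTypeR R)) : measurableTypeR R := tnth t i.

Let orthant (c : 'I_n -> R) : set (n.-tuple (measurableTypeR R)) :=
  [set t | forall i, c i < tnth t i].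

Let measurable_orthantE :
  @measurable _ (n.-tuple (measurableTypeR R)) = <<s range orthant >>.
Proof.
have orthantI i x : coord i @^-1` `]x, +oo[ =
    \bigcup_k orthant (fun j => if j == i then x else - k%:R).
  apply/seteqP; split => [t /= |t [k _ /(_ i)]]; last first.
    by rewrite eqxx /= in_itv/= andbT.
  rewrite in_itv/= andbT => xt.
  exists (Num.truncn (\sum_j `|tnth t j|)).+1 => // j.
  case: eqP => [->//|_]; rewrite ltrNl.
  apply: le_lt_trans (truncnS_gt _); rewrite (bigD1 j)//= -normrN.
  by rewrite ler_wpDr ?ler_norm// sumr_ge0.
apply/seteqP; split; last first.
  apply: smallest_sub; first exact: sigma_algebra_measurable.
  move=> _ [c _ <-].
  rewrite (_ : orthant c = \bigcap_(i in [set: 'I_n]) (coord i @^-1` `]c i, +oo[)).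
    apply: fin_bigcap_measurable => // i _.
    by rewrite -[X in measurable X]setTI; apply: measurable_tnth.
  apply/seteqP; split => t /= ct i; first by rewrite /= in_itv/= ct.
  by have := ct i I; rewrite /= in_itv/= andbT.
apply: smallest_sub; first exact: smallest_sigma_algebra.
move=> A; rewrite -bigcup_seq => -[i _ [B mB <-]]; rewrite setTI.
have : <<s @RGenOInfty.G R >> B.
  rewrite -[X in X B]/((@RGenOInfty.G R).-sigma.-measurable).
  by rewrite -RGenOInfty.measurableE.
apply: (smallest_sub (X := [set B | <<s range orthant >> (coord i @^-1` B)])).
  split => [|C /= sC|C /= sC].
  - by rewrite /= preimage_set0; exact: sigma_algebra0.
  - by rewrite setTD -preimage_setC -setTD; exact: sigma_algebraCD.
  - by rewrite preimage_bigcup; exact: sigma_algebra_bigcup.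
move=> _ [x ->] /=; rewrite orthantI; apply: sigma_algebra_bigcup => k.
exact: sub_sigma_algebra.
Qed.

Let measurable_tupleY d1 (T1 : measurableType d1) (Z : 'I_n -> T1 -> R) :
  (forall i, measurable_fun setT (Z i)) -> measurable_fun setT (tupleY Z).
Proof.
move=> mZ; apply/measurable_fun_tnthP => i.
apply: (eq_measurable_fun (Z i)) => [w _|]; last exact: mZ.
by rewrite /= tnth_mktuple.
Qed.

Lemma eq_law_cos_mean (U : set (n.-tuple (measurableTypeR R))) : measurable U ->
  P ((fun w => [tuple Y j w | j < n]) @^-1` U) =
  P' ((fun w => [tuple Y' j w | j < n]) @^-1` U).
Proof.
move=> mU.
have mt := measurable_tupleY mY; have mt' := measurable_tupleY mY'.
pose m1 := [the measure _ _ of pushforward P (tupleY Y)].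
pose m2 := [the measure _ _ of pushforward P' (tupleY Y')].
apply: (@measure_unique _ _ _ (range orthant) (fun k => orthant (fun=> - k%:R))
  measurable_orthantE _ _ _ (m1 mt) (m2 mt') _ _ U mU).
- move=> _ _ [c _ <-] [c' _ <-]; exists (fun i => Num.max (c i) (c' i)) => //.
  apply/seteqP; split => t /=.
    by move=> h; split => i; have := h i; rewrite gt_max => /andP[].
  by move=> [h h'] i; rewrite gt_max h h'.
- by move=> k; exists (fun=> - k%:R).
- apply/seteqP; split => // t _.
  exists (Num.truncn (\sum_j `|tnth t j|)).+1 => // j; rewrite ltrNl.
  apply: le_lt_trans (truncnS_gt _); rewrite (bigD1 j)//= -normrN.
  by rewrite ler_wpDr ?ler_norm// sumr_ge0.
- move=> _ [c _ <-]; have := orthant_prob c.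
  congr (P _ = P' _); apply/seteqP; split => w /= h i; have := h i;
    by rewrite tnth_mktuple.
- move=> k; apply: (@le_lt_trans _ _ 1%E); last exact: ltry.
  by apply: probability_le1; rewrite -[X in measurable X]setTI; apply: mt => //;
    rewrite measurable_orthantE; apply: sub_sigma_algebra; exists (fun=> - k%:R).
Qed.

End cramer_wold.

Lemma cramer_wold (R : realType) d (T : measurableType d) (P : probability T R)
    d' (T' : measurableType d') (P' : probability T' R) (n : nat)
    (Y : 'I_n -> T -> R) (Y' : 'I_n -> T' -> R) :
  (forall i, measurable_fun setT (Y i)) ->
  (forall i, measurable_fun setT (Y' i)) ->
  (forall (a : 'I_n -> R) (U : set R), measurable U ->
    P ((fun w => \sum_i a i * Y i w) @^-1` U) =
    P' ((fun w => \sum_i a i * Y' i w) @^-1` U)) ->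
  forall U : set (n.-tuple (measurableTypeR R)), measurable U ->
  P ((fun w => [tuple Y j w | j < n]) @^-1` U) =
  P' ((fun w => [tuple Y' j w | j < n]) @^-1` U).
Proof.
move=> mY mY' YY' U; apply: eq_law_cos_mean => // a b.
apply: (eq_bounded_expectation_law _ _ (YY' a) (measurable_cos_affine b)).
- by apply: measurable_sum => i; exact: measurable_funM.
- by apply: measurable_sum => i; exact: measurable_funM.
- by move=> x; exact: cos_max.
Qed.

Lemma eq_real_law_cos_mean (R : realType) d (T : measurableType d)
    (P : probability T R) d' (T' : measurableType d') (P' : probability T' R)
    (X : T -> R) (X' : T' -> R) :
  measurable_fun setT X -> measurable_fun setT X' ->
  (forall a b, \int[P]_w cos (a * X w + b) = \int[P']_w cos (a * X' w + b)) ->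
  forall U : set R, measurable U -> P (X @^-1` U) = P' (X' @^-1` U).
Proof.
move=> mX mX' cosX U mU.
pose C : set (1.-tuple (measurableTypeR R)) :=
  (fun t : 1.-tuple (measurableTypeR R) => tnth t ord0) @^-1` U.
have mC : measurable C.
  by rewrite -[X in measurable X]setTI; apply: measurable_tnth.
have CE d1 (T1 : measurableType d1) (Z : T1 -> R) :
    (fun w => [tuple Z w | _ < 1] : 1.-tuple (measurableTypeR R)) @^-1` C = Z @^-1` U.
  by apply/seteqP; split => w; rewrite /C/= tnth_mktuple.
have := eq_law_cos_mean (Y := fun _ : 'I_1 => X) (Y' := fun=> X')
  (fun=> mX) (fun=> mX') _ mC.
rewrite !CE; apply=> a b.
  by under eq_Rintegral do rewrite big_ord1;
  under [RHS]eq_Rintegral do rewrite big_ord1; exact: cosX.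
Qed.

(** * Centered normal laws *)

Lemma continuous_comp_norm (R : realType) (f : R -> R) :
  {within `[0, +oo[, continuous f} -> continuous (fun t : R => f `|t|).
Proof.
move=> /subspace_continuousP cf x.
have x0 : `[0, +oo[%classic `|x| by rewrite /= in_itv/= normr_ge0.
apply: cvg_comp (cf _ x0) => A /= nA.
have cn : `|y| @[y --> x] --> `|x| by exact: cvg_norm.
have nA' : \forall y \near x, `[0, +oo[%classic `|y| -> A `|y| := cn _ nA.
apply: filterS nA' => y; apply.
by rewrite /= in_itv/= normr_ge0.
Qed.

Section centered_normal.
Context (R : realType).

Lemma ae_eq_prob d (T : measurableType d) (P : probability T R) (A B : set T) :
  measurable A -> measurable B -> {ae P, forall w, A w <-> B w} -> P A = P B.
Proof.
move=> mA mB [N [mN N0 subN]].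
have sub A1 B1 : measurable A1 -> measurable B1 ->
    (forall w, ~ N w -> A1 w -> B1 w) -> (P A1 <= P B1)%E.
  move=> mA1 mB1 AB; rewrite -[leRHS]adde0 -N0.
  apply: le_trans (measureU2 _ mB1 mN); apply: le_measure; rewrite ?inE//.
    exact: measurableU.
  by move=> w A1w; have [Nw|Nw] := pselect (N w); [right|left; exact: AB].
have ABw w : ~ N w -> A w <-> B w.
  by move=> Nw; apply: contrapT => AB; apply: Nw; exact: subN.
by apply/eqP; rewrite eq_le !sub// => w /ABw[].
Qed.

Lemma centered_normal_law_ae d (T : measurableType d) (P : probability T R) v
    (X X' : T -> R) : measurable_fun setT X' -> {ae P, forall w, X w = X' w} ->
  centered_normal_law P v X -> centered_normal_law P v X'.
Proof.
move=> mX' XX' [mX v0 lX]; split => // U mU; rewrite -lX//.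
apply: ae_eq_prob.
- by rewrite -[X in measurable X]setTI; exact: mX'.
- by rewrite -[X in measurable X]setTI; exact: mX.
- by apply: filterS XX' => w /= ->.
Qed.

Lemma independent_pair_law d (T : measurableType d) (P : probability T R)
    d' (T' : measurableType d') (P' : probability T' R)
    (X V : T -> R) (X' V' : T' -> R) :
  measurable_fun setT X -> measurable_fun setT V ->
  measurable_fun setT X' -> measurable_fun setT V' ->
  (forall A B : set R, measurable A -> measurable B ->
    P (X @^-1` A `&` V @^-1` B) = P' (X' @^-1` A `&` V' @^-1` B)) ->
  forall Q : set (R * R), measurable Q ->
    P ((fun w => (X w, V w)) @^-1` Q) = P' ((fun w => (X' w, V' w)) @^-1` Q).
Proof.
move=> mX mV mX' mV' XV Q mQ.
have mp : measurable_fun setT (fun w => (X w, V w)) by exact/measurable_fun_pair.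
have mp' : measurable_fun setT (fun w => (X' w, V' w)).
  exact/measurable_fun_pair.
pose m1 := [the measure _ _ of pushforward P (fun w => (X w, V w))].
pose m2 := [the measure _ _ of pushforward P' (fun w => (X' w, V' w))].
apply: (@measure_unique _ _ _
  [set A `*` B | A in measurable & B in measurable] (fun=> setT)
  (measurable_prod_measurableType _ _) _ _ _ (m1 mp) (m2 mp') _ _ Q mQ).
- move=> _ _ [A mA [B mB <-]] [A' mA' [B' mB' <-]].
  exists (A `&` A'); first exact: measurableI.
  by exists (B `&` B'); [exact: measurableI|rewrite setXI].
- by move=> _; exists setT => //; exists setT => //; rewrite setXTT.
- by rewrite bigcup_const.
- by move=> _ [A mA [B mB <-]]; exact: XV.
- by move=> _; rewrite /= /pushforward preimage_setT probability_setT ltry.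
Qed.

Section reference.
Context d0 (T0 : measurableType d0) (P0 : probability T0 R) (U : R -> T0 -> R).
Hypothesis HU : standard_brownian_motion P0 U.

Lemma standard_brownian_law v : 0 <= v -> centered_normal_law P0 v (U v).
Proof.
move=> v0; have := bm_increment_law HU (lexx 0) v0 1%:M.
rewrite subr0 trmx1 mulmx1 mul1mx mxE mxE eqxx mulr1.
apply: centered_normal_law_ae; first exact: (bm_measurable HU ord0 v0).
apply: filterS (bm_start HU) => w U0; rewrite big_ord1 mxE eqxx mul1r.
by rewrite (U0 ord0) subr0.
Qed.

Lemma standard_brownian_increment_law u v : 0 <= u -> 0 <= v ->
  centered_normal_law P0 v (fun w => U (u + v) w - U u w).
Proof.
move=> u0 v0; have := bm_increment_law HU u0 (_ : u <= u + v) 1%:M.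
rewrite lerDl => /(_ v0).
rewrite addrAC subrr add0r trmx1 mulmx1 mul1mx mxE mxE eqxx mulr1.
apply: centered_normal_law_ae.
  by apply: measurable_funB; apply: (bm_measurable HU ord0) => //; exact: addr_ge0.
by apply: aeW => w; rewrite big_ord1 mxE eqxx mul1r.
Qed.

Lemma centered_normal_law_indep_sum d (T : measurableType d)
    (P : probability T R) u v (X V : T -> R) :
  centered_normal_law P u X -> centered_normal_law P v V ->
  (forall A B : set R, measurable A -> measurable B ->
    P (X @^-1` A `&` V @^-1` B) = (P (X @^-1` A) * P (V @^-1` B))%E) ->
  centered_normal_law P (u + v) (fun w => X w + V w).
Proof.
move=> [mX u0 lX] [mV v0 lV] XV.
have [mU _ lU] := standard_brownian_law u0.
have [mD _ lD] := standard_brownian_increment_law u0 v0.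
have [_ _ lS] := standard_brownian_law (addr_ge0 u0 v0).
split; [exact: measurable_funD|exact: addr_ge0|move=> B mB].
have mQ : measurable ((fun q : R * R => q.1 + q.2) @^-1` B).
  rewrite -[X in measurable X]setTI.
  by apply: (measurable_funD measurable_fst measurable_snd).
have := independent_pair_law (P := P) (P' := P0) mX mV mU mD _ mQ.
rewrite -lS// => ->.
  by congr (P0 _); apply/seteqP; split => w /=; rewrite addrCA subrr addr0.
move=> A B' mA mB'; have lXU := etrans (lX _ mA) (esym (lU _ mA)).
have lVD := etrans (lV _ mB') (esym (lD _ mB')).
rewrite (XV _ _ mA mB') lXU lVD setIC muleC; symmetry.
apply: (bm_increment_indep HU u0 (_ : u <= u + v)); first by rewrite lerDl.
- by apply: sub_sigma_algebra; exists ord0 => //; exists B'.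
- apply: sub_sigma_algebra; exists (u, ord0); last by exists A.
  by rewrite /= u0 lexx.
Qed.

Lemma centered_normal_law_limit d (T : measurableType d) (P : probability T R)
    (X_ : nat -> T -> R) (v_ : nat -> R) (X : T -> R) (v : R) :
  (forall n, centered_normal_law P (v_ n) (X_ n)) -> measurable_fun setT X ->
  {ae P, forall w, X_ ^~ w @ \oo --> X w} -> v_ @ \oo --> v ->
  centered_normal_law P v X.
Proof.
move=> lX_ mX XX vv.
have v_0 n : 0 <= v_ n by have [] := lX_ n.
have v0 : 0 <= v.
  by apply: (ler_cvg_to (cvg_cst 0) vv); apply: nearW.
have [mU _ lU] := standard_brownian_law v0.
split => // B mB; rewrite -lU//; apply: eq_real_law_cos_mean => // a b {B mB}.
have mcos d1 (T1 : measurableType d1) (Z : T1 -> R) :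
    measurable_fun setT Z -> measurable_fun setT (fun w => cos (a * Z w + b)).
  move=> mZ; apply: (measurableT_comp (measurable_cos_affine b)).
  exact: measurable_funM.
have ccos : continuous (fun x : R => cos (a * x + b)).
  move=> x; apply: continuous_comp; last exact: continuous_cos.
  by apply: cvgD; [apply: cvgM; [exact: cvg_cst|exact: cvg_id]|exact: cvg_cst].
have mUn n : measurable_fun setT (U (v_ n)) by have [] := standard_brownian_law (v_0 n).
have cX := @cvg_bounded_expectation _ T R P
  (fun n w => cos (a * X_ n w + b)) (fun w => cos (a * X w + b)) 1.
have cU := @cvg_bounded_expectation _ T0 R P0
  (fun n w => cos (a * U (v_ n) w + b)) (fun w => cos (a * U v w + b)) 1.
apply: (cvg_unique _ (cX _ _ _ _)) => //.
- by move=> n; apply: mcos; have [] := lX_ n.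
- exact: mcos.
- apply: filterS XX => w XXw.
  by apply: (@continuous_cvg _ _ _ _ _ _ _ (X w) (ccos _)).
- by move=> n w; exact: cos_max.
apply: cvg_trans (cU _ _ _ _) => //.
- apply: near_eq_cvg; apply: nearW => n.
  have [mXn _ lXn] := lX_ n; have [mUn' _ lUn] := standard_brownian_law (v_0 n).
  apply: (eq_bounded_expectation_law (P := P0) (P' := P)
    (f := fun x => cos (a * x + b)) mUn' mXn _ _ (fun x => cos_max _)).
    by move=> B mB; rewrite (lUn _ mB) (lXn _ mB).
  exact: mcos.
- by move=> n; exact: mcos.
- exact: mcos.
- apply: filterS (bm_continuous HU) => w /(_ ord0) cUw.
  apply: (@continuous_cvg _ _ _ _ _ _ _ (U v w) (ccos _)).
  have -> : (fun n => U (v_ n) w) = (fun t : R => U `|t| w) \o v_.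
    by apply/funext => n; rewrite /= ger0_norm.
  rewrite -[X in U X w]ger0_norm//.
  exact: (continuous_cvg _ (continuous_comp_norm cUw (x := v)) vv).
- by move=> n w; exact: cos_max.
Qed.
End reference.
End centered_normal.

(** * Gaussian families *)

Section gaussian_families.
Context (R : realType).

Definition lincomb T I (Y : I -> T -> R) (s : seq (R * I)) (w : T) : R :=
  \sum_(p <- s) p.1 * Y p.2 w.

Definition bilin I (K : I -> I -> R) (s s' : seq (R * I)) : R :=
  \sum_(p <- s) \sum_(q <- s') p.1 * q.1 * K p.2 q.2.

Definition gaussian_family d (T : measurableType d) (P : probability T R) I
    (Y : I -> T -> R) (K : I -> I -> R) : Prop :=
  forall s, centered_normal_law P (bilin K s s) (lincomb Y s).

Lemma eq_gaussian_family d (T : measurableType d) (P : probability T R) I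
    (Y Y' : I -> T -> R) (K K' : I -> I -> R) :
  (forall i w, Y i w = Y' i w) -> (forall i j, K i j = K' i j) ->
  gaussian_family P Y K -> gaussian_family P Y' K'.
Proof.
move=> YY' KK'; have -> : Y = Y' by apply/funext => i; apply/funext => w.
by have -> : K = K' by apply/funext => i; apply/funext => j.
Qed.

Definition subst_comb I J (c : J -> seq (R * I)) (s : seq (R * J)) :
    seq (R * I) :=
  flatten [seq [seq (p.1 * q.1, q.2) | q <- c p.2] | p <- s].

Lemma lincomb_subst T I J (Y : I -> T -> R) (c : J -> seq (R * I)) s w :
  lincomb Y (subst_comb c s) w = lincomb (fun j => lincomb Y (c j)) s w.
Proof.
rewrite /lincomb /subst_comb big_flatten big_map; apply: eq_bigr => p _.
by rewrite big_map big_distrr/=; apply: eq_bigr => q _; rewrite mulrA.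
Qed.

Lemma bilin_subst I J (K : I -> I -> R) (c : J -> seq (R * I)) s s' :
  bilin K (subst_comb c s) (subst_comb c s') =
  bilin (fun j j' => bilin K (c j) (c j')) s s'.
Proof.
rewrite /bilin /subst_comb big_flatten big_map; apply: eq_bigr => p _.
rewrite big_map.
under eq_bigr => q _ do rewrite big_flatten big_map.
rewrite exchange_big/=; apply: eq_bigr => p' _.
rewrite big_distrr/=; apply: eq_bigr => q _.
rewrite big_map big_distrr/=; apply: eq_bigr => q' _.
by ring.
Qed.

Lemma bilinD I (K K' : I -> I -> R) s s' :
  bilin (fun i j => K i j + K' i j) s s' = bilin K s s' + bilin K' s s'.
Proof.
rewrite /bilin -big_split; apply: eq_bigr => p _ /=.
by rewrite -big_split; apply: eq_bigr => q _; rewrite /= mulrDr.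
Qed.

Lemma lincombD T I (Y Y' : I -> T -> R) s w :
  lincomb (fun i w => Y i w + Y' i w) s w = lincomb Y s w + lincomb Y' s w.
Proof.
by rewrite /lincomb -big_split; apply: eq_bigr => p _ /=; rewrite mulrDr.
Qed.

Section one_space.
Context d (T : measurableType d) (P : probability T R) (I : Type)
  (Y : I -> T -> R) (K : I -> I -> R).
Hypothesis gY : gaussian_family P Y K.

Lemma gaussian_family_measurable i : measurable_fun setT (Y i).
Proof.
have [mY _ _] := gY [:: (1, i)]; apply: eq_measurable_fun mY => w _.
by rewrite /lincomb big_seq1 mul1r.
Qed.

Lemma gaussian_family_subst J (c : J -> seq (R * I)) :
  gaussian_family P (fun j => lincomb Y (c j)) (fun j j' => bilin K (c j) (c j')).
Proof.
move=> s; rewrite -bilin_subst.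
have -> : lincomb (fun j => lincomb Y (c j)) s = lincomb Y (subst_comb c s).
  by apply/funext => w; rewrite lincomb_subst.
exact: gY.
Qed.

Lemma gaussian_family_reindex J (a : J -> R) (k : J -> I) :
  gaussian_family P (fun j w => a j * Y (k j) w)
    (fun j j' => a j * a j' * K (k j) (k j')).
Proof.
apply: eq_gaussian_family (gaussian_family_subst (fun j => [:: (a j, k j)])).
  by move=> j w; rewrite /lincomb big_seq1.
by move=> j j'; rewrite /bilin !big_seq1.
Qed.

Lemma gaussian_family_same_law d' (T' : measurableType d')
    (P' : probability T' R) (Y' : I -> T' -> R) :
  gaussian_family P' Y' K -> forall D : set I, same_law D P Y P' Y'.
Proof.
move=> gY' D n k _ U mU.
apply: (@cramer_wold _ _ _ P _ _ P' n (fun j => Y (k j)) (fun j => Y' (k j))) => //.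
- by move=> i; exact: gaussian_family_measurable.
- by move=> i; have [mY' _ _] := gY' [:: (1, k i)]; apply: eq_measurable_fun mY' => w _;
    rewrite /lincomb big_seq1 mul1r.
move=> a V mV; pose s := [seq (a i, k i) | i <- index_enum 'I_n].
have sE d1 (T1 : measurableType d1) (Z : I -> T1 -> R) :
    (fun w => \sum_i a i * Z (k i) w) = lincomb Z s.
  by apply/funext => w; rewrite /lincomb big_map.
rewrite !sE; have [_ _ ->] // := gY s; have [_ _ ->] // := gY' s.
Qed.

Lemma gaussian_family_box d' (T' : measurableType d')
    (P' : probability T' R) (Y' : I -> T' -> R) :
  gaussian_family P' Y' K ->
  forall s : seq ({B : set R | measurable B} * I),
  P (\big[setI/setT]_(p <- s) (Y p.2 @^-1` sval p.1)) =
  P' (\big[setI/setT]_(p <- s) (Y' p.2 @^-1` sval p.1)).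
Proof.
move=> gY' s; pose n := size s.
pose k (j : 'I_n) := (tnth (in_tuple s) j).2.
pose coord (j : 'I_n) (t : n.-tuple (measurableTypeR R)) := tnth t j.
pose U := \big[setI/setT]_(j < n) (coord j @^-1` sval (tnth (in_tuple s) j).1).
have mU : measurable U.
  apply: bigsetI_measurable => j _; rewrite -[X in measurable X]setTI.
  by apply: measurable_tnth => //; exact: proj2_sig.
have boxE d1 (T1 : measurableType d1) (Z : I -> T1 -> R) :
    \big[setI/setT]_(p <- s) (Z p.2 @^-1` sval p.1) =
    (fun w => [tuple Z (k j) w | j < n] : n.-tuple (measurableTypeR R)) @^-1` U.
  pose f w : n.-tuple (measurableTypeR R) := [tuple Z (k j) w | j < n].
  rewrite big_tnth /U -[RHS]/(f @^-1` _).
  rewrite (big_morph _ (preimage_setI f) (preimage_setT f)).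
  apply: eq_bigr => j _; apply/seteqP.
  by split => w; rewrite /coord/= tnth_mktuple.
by rewrite !boxE; exact: (gaussian_family_same_law gY' (D := setT) (k := k)).
Qed.

End one_space.
End gaussian_families.

Lemma independent_generated (R : realType) d (T : measurableType d)
    (P : probability T R) (G1 G2 : set (set T)) :
  G1 `<=` measurable -> G2 `<=` measurable -> setI_closed G1 -> setI_closed G2 ->
  G1 setT -> G2 setT ->
  (forall A B, G1 A -> G2 B -> P (A `&` B) = (P A * P B)%E) ->
  independent_sigma P <<s G1>> <<s G2>>.
Proof.
move=> mG1 mG2 I1 I2 G1T G2T G12.
have half (H1 : set (set T)) (B : set T) : H1 `<=` measurable ->
    setI_closed H1 -> H1 setT -> measurable B ->
    (forall A, H1 A -> P (A `&` B) = (P A * P B)%E) ->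
    forall A, <<s H1>> A -> P (A `&` B) = (P A * P B)%E.
  move=> mH1 IH1 H1T mB HB A sA.
  have PB0 : 0 <= fine (P B) by rewrite fine_ge0.
  have PBE : P B = (fine (P B))%:E by rewrite fineK// fin_num_measure.
  have E := @g_sigma_algebra_measure_unique _ R T H1 mH1 (fun=> setT) (fun=> H1T)
    _ [the measure _ _ of mrestr P mB] [the measure _ _ of mscale (NngNum PB0) P].
  rewrite muleC PBE; apply: E => //.
  - by rewrite bigcup_const.
  - move=> C HC; change (P (C `&` B) = ((fine (P B))%:E * P C)%E).
    by rewrite -PBE HB// muleC.
  - move=> _; rewrite /= /mrestr setTI; apply: le_lt_trans (ltry 1).
    exact: probability_le1.
have mS1 A : <<s G1>> A -> measurable A.
  by apply: smallest_sub => //; exact: sigma_algebra_measurable.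
move=> A B sA sB; apply: (half G1) => //.
  by apply: (smallest_sub _ mG2) sB; exact: sigma_algebra_measurable.
move=> A1 GA1; rewrite setIC muleC; apply: (half G2) => //; first exact: mG1.
by move=> B1 GB1; rewrite setIC muleC; exact: G12.
Qed.

Section gaussian_closure.
Context (R : realType) d0 (T0 : measurableType d0) (P0 : probability T0 R)
  (U : R -> T0 -> R).
Hypothesis HU : standard_brownian_motion P0 U.

Lemma gaussian_family_limit d (T : measurableType d) (P : probability T R) I
    (Y_ : nat -> I -> T -> R) (K_ : nat -> I -> I -> R)
    (Y : I -> T -> R) (K : I -> I -> R) :
  (forall n, gaussian_family P (Y_ n) (K_ n)) ->
  (forall i, measurable_fun setT (Y i)) ->
  (forall i, {ae P, forall w, Y_ n i w @[n --> \oo] --> Y i w}) ->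
  (forall i j, K_ n i j @[n --> \oo] --> K i j) ->
  gaussian_family P Y K.
Proof.
move=> gY mY YY KK s.
apply: (centered_normal_law_limit HU (X_ := fun n => lincomb (Y_ n) s)
  (v_ := fun n => bilin (K_ n) s s)).
- by move=> n; exact: gY.
- by apply: measurable_sum => p; exact: measurable_funM.
- elim: s => [|p s IHs].
    by apply: aeW => w; rewrite /lincomb big_nil; under eq_fun do rewrite big_nil;
      exact: cvg_cst.
  have := YY p.2; apply: filterS2 IHs => w cs cp.
  rewrite /lincomb big_cons; under eq_fun do rewrite big_cons.
  by apply: cvgD => //; apply: cvgM => //; exact: cvg_cst.
- rewrite /bilin; apply: cvg_big => // [|p _]; first exact: add_continuous.
  apply: cvg_big => // [|q _]; first exact: add_continuous.
  by apply: cvgM => //; exact: cvg_cst.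
Qed.

Lemma gaussian_family_product_sum d1 (T1 : measurableType d1)
    (P1 : probability T1 R) d2 (T2 : measurableType d2) (P2 : probability T2 R)
    I (Y1 : I -> T1 -> R) (Y2 : I -> T2 -> R) K1 K2 :
  gaussian_family P1 Y1 K1 -> gaussian_family P2 Y2 K2 ->
  gaussian_family (P1 \x P2)%E (fun i w => Y1 i w.1 + Y2 i w.2)
    (fun i j => K1 i j + K2 i j).
Proof.
move=> g1 g2 s; rewrite bilinD.
have -> : lincomb (fun i w => Y1 i w.1 + Y2 i w.2) s =
    (fun w : T1 * T2 => lincomb Y1 s w.1 + lincomb Y2 s w.2).
  by apply/funext => w; rewrite lincombD.
have [m1 v1 l1] := g1 s; have [m2 v2 l2] := g2 s.
have E1 (A : set R) : measurable A ->
    (P1 \x P2)%E ((lincomb Y1 s \o fst) @^-1` A) = P1 (lincomb Y1 s @^-1` A).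
  move=> mA; have -> : (lincomb Y1 s \o fst) @^-1` A =
      (lincomb Y1 s @^-1` A) `*` [set: T2].
    by apply/seteqP; split => -[x y] //= [].
  rewrite product_measure1E//; last first.
    by rewrite -[X in measurable X]setTI; exact: m1.
  by rewrite -[RHS]mule1; congr (_ * _)%E; exact: probability_setT.
have E2 (A : set R) : measurable A ->
    (P1 \x P2)%E ((lincomb Y2 s \o snd) @^-1` A) = P2 (lincomb Y2 s @^-1` A).
  move=> mA; have -> : (lincomb Y2 s \o snd) @^-1` A =
      [set: T1] `*` (lincomb Y2 s @^-1` A).
    by apply/seteqP; split => -[x y] //= [].
  rewrite product_measure1E//; last first.
    by rewrite -[X in measurable X]setTI; exact: m2.
  by rewrite -[RHS]mul1e; congr (_ * _)%E; exact: probability_setT.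
apply: (centered_normal_law_indep_sum HU (X := lincomb Y1 s \o fst)
  (V := lincomb Y2 s \o snd)).
- split; [exact: measurableT_comp|exact: v1|move=> B mB].
  by rewrite -(l1 _ mB); exact: E1.
- split; [exact: measurableT_comp|exact: v2|move=> B mB].
  by rewrite -(l2 _ mB); exact: E2.
- move=> A B mA mB.
  have -> : (lincomb Y1 s \o fst) @^-1` A `&` (lincomb Y2 s \o snd) @^-1` B =
      (lincomb Y1 s @^-1` A) `*` (lincomb Y2 s @^-1` B).
    by apply/seteqP; split => -[x y] //= [].
  transitivity (P1 (lincomb Y1 s @^-1` A) * P2 (lincomb Y2 s @^-1` B))%E.
    apply: product_measure1E.
      by rewrite -[X in measurable X]setTI; exact: m1.
    by rewrite -[X in measurable X]setTI; exact: m2.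
  by congr (_ * _)%E; symmetry; [exact: E1|exact: E2].
Qed.

End gaussian_closure.

Section gaussian_independence.
Context (R : realType) d0 (T0 : measurableType d0) (P0 : probability T0 R)
  (U : R -> T0 -> R).
Hypothesis HU : standard_brownian_motion P0 U.
Context d (T : measurableType d) (P : probability T R).

Definition sum_family I1 I2 (Y1 : I1 -> T -> R) (Y2 : I2 -> T -> R)
    (u : I1 + I2) : T -> R :=
  match u with inl i => Y1 i | inr j => Y2 j end.

Lemma gaussian_independent I1 I2 (D1 : set I1) (D2 : set I2)
    (Y1 : I1 -> T -> R) (Y2 : I2 -> T -> R) K :
  gaussian_family P (sum_family Y1 Y2) K ->
  (forall i j, D1 i -> D2 j -> K (inl i) (inr j) = 0 /\ K (inr j) (inl i) = 0) ->
  independent_sigma P (sigma_of D1 Y1) (sigma_of D2 Y2).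
Proof.
move=> gY K0.
pose MB := {B : set R | measurable B}.
pose J1 := {i | D1 i}; pose J2 := {j | D2 j}.
pose proj (u : J1 + J2) : I1 + I2 :=
  match u with inl i => inl (sval i) | inr j => inr (sval j) end.
pose c1 (u : J1 + J2) : seq (R * (I1 + I2)) :=
  if u is inl i then [:: (1, inl (sval i))] else [::].
pose c2 (u : J1 + J2) : seq (R * (I1 + I2)) :=
  if u is inr j then [:: (1, inr (sval j))] else [::].
have gJ : gaussian_family P (fun u => sum_family Y1 Y2 (proj u))
    (fun u v => K (proj u) (proj v)).
  apply: eq_gaussian_family (gaussian_family_reindex gY (fun=> 1) proj).
    by move=> u w; rewrite mul1r.
  by move=> u v; rewrite !mul1r.
have gJ' : gaussian_family (P \x P)%E
    (fun u w => match u with inl i => Y1 (sval i) w.1 | inr j => Y2 (sval j) w.2 end)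
    (fun u v => K (proj u) (proj v)).
  apply: eq_gaussian_family (gaussian_family_product_sum HU
    (gaussian_family_subst gY c1) (gaussian_family_subst gY c2)).
    by move=> [i|j] w; rewrite /lincomb /= big_seq1 big_nil mul1r ?addr0 ?add0r.
  move=> [i|j] [i'|j']; rewrite /bilin /= ?big_seq1 ?big_nil ?mul1r ?addr0 ?add0r//.
  - by rewrite (K0 _ _ (svalP i) (svalP j')).1.
  - by rewrite (K0 _ _ (svalP i') (svalP j)).2.
pose G1 : set (set T) := range (fun s : seq (MB * J1) =>
  \big[setI/setT]_(p <- s) (Y1 (sval p.2) @^-1` sval p.1)).
pose G2 : set (set T) := range (fun s : seq (MB * J2) =>
  \big[setI/setT]_(p <- s) (Y2 (sval p.2) @^-1` sval p.1)).
have mY1 i : measurable_fun setT (Y1 i) := gaussian_family_measurable gY (inl i).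
have mY2 i : measurable_fun setT (Y2 i) := gaussian_family_measurable gY (inr i).
have mG1 : G1 `<=` measurable.
  move=> _ [s _ <-]; apply: bigsetI_measurable => p _.
  by rewrite -[X in measurable X]setTI; apply: mY1 => //; exact: proj2_sig.
have mG2 : G2 `<=` measurable.
  move=> _ [s _ <-]; apply: bigsetI_measurable => p _.
  by rewrite -[X in measurable X]setTI; apply: mY2 => //; exact: proj2_sig.
have G12 : independent_sigma P <<s G1>> <<s G2>>.
  apply: independent_generated => //.
  - by move=> _ _ [s _ <-] [s' _ <-]; exists (s ++ s') => //; rewrite big_cat.
  - by move=> _ _ [s _ <-] [s' _ <-]; exists (s ++ s') => //; rewrite big_cat.
  - by exists [::] => //; rewrite big_nil.
  - by exists [::] => //; rewrite big_nil.
  move=> _ _ [s1 _ <-] [s2 _ <-].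
  pose s : seq (MB * (J1 + J2)) :=
    [seq (p.1, inl p.2) | p <- s1] ++ [seq (p.1, inr p.2) | p <- s2].
  have := gaussian_family_box gJ gJ' s; rewrite !big_cat !big_map/= => ->.
  rewrite -product_measure1E; [|by apply: mG1; exists s1|by apply: mG2; exists s2].
  congr (_ _); apply/esym.
  have -> : forall (E1 E2 : set T), E1 `*` E2 = fst @^-1` E1 `&` snd @^-1` E2 by [].
  rewrite (big_morph _ (preimage_setI (@fst T T)) (preimage_setT _)).
  by rewrite (big_morph _ (preimage_setI (@snd T T)) (preimage_setT _)).
move=> A B sA sB; apply: G12.
  apply: smallest_sub sA; first exact: smallest_sigma_algebra.
  move=> _ [i Di [V mV ->]]; apply: sub_sigma_algebra.
  by exists [:: (exist _ V mV, exist _ i Di)] => //; rewrite big_seq1.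
apply: smallest_sub sB; first exact: smallest_sigma_algebra.
move=> _ [i Di [V mV ->]]; apply: sub_sigma_algebra.
by exists [:: (exist _ V mV, exist _ i Di)] => //; rewrite big_seq1.
Qed.

End gaussian_independence.

(** * Brownian motion as a Gaussian family *)

Lemma mulmx_form_sum (R : realType) (m : nat) (C : 'M[R]_m) I
    (s : seq (R * I)) (a : I -> 'rV[R]_m) :
  let v := \sum_(p <- s) p.1 *: a p.2 in
  (v *m C *m v^T) ord0 ord0 = \sum_(p <- s) \sum_(q <- s)
    p.1 * q.1 * (a p.2 *m C *m (a q.2)^T) ord0 ord0.
Proof.
rewrite /= mulmx_suml mulmx_suml summxE; apply: eq_bigr => p _.
rewrite linear_sum mulmx_sumr summxE; apply: eq_bigr => q _.
by rewrite linearZ -scalemxAr -!scalemxAl [LHS]mxE [in LHS]mxE; ring.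
Qed.

Section brownian_grid.
Context (R : realType) d (T : measurableType d) (P : probability T R)
  (m : nat) (C : 'M[R]_m) (W : R -> 'I_m -> T -> R).
Hypothesis HW : brownian_motion P C W.
Context d0 (T0 : measurableType d0) (P0 : probability T0 R) (U : R -> T0 -> R).
Hypothesis HU : standard_brownian_motion P0 U.
Variable (N : nat).

Definition grid_incr (k : nat) (i : 'I_m) (w : T) : R :=
  W (k.+1%:R / N.+1%:R) i w - W (k%:R / N.+1%:R) i w.

Definition grid_sum (a : nat -> 'rV[R]_m) (n : nat) (w : T) : R :=
  \sum_(k < n) \sum_i a k ord0 i * grid_incr k i w.

Let past (u : R) : set (set T) :=
  [set E | exists2 k : R * 'I_m, 0 <= k.1 <= u & exists2 V : set R, measurable V &
    E = W k.1 k.2 @^-1` V].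

Let grid_sum_past (a : nat -> 'rV[R]_m) n :
  measurable_fun (setT : set (g_sigma_algebraType (past (n%:R / N.+1%:R)))) (grid_sum a n).
Proof.
have mW k i : (k <= n)%N -> measurable_fun
    (setT : set (g_sigma_algebraType (past (n%:R / N.+1%:R)))) (W (k%:R / N.+1%:R) i).
  move=> kn _ V mV; rewrite setTI; apply: sub_sigma_algebra.
  exists (k%:R / N.+1%:R, i); last by exists V.
  by rewrite /= divr_ge0//= ler_pM2r ?invr_gt0// ler_nat.
apply: measurable_sum => k; apply: measurable_sum => i; apply: measurable_funM => //.
by apply: measurable_funB; apply: mW; [exact: ltn_ord|exact: ltnW].
Qed.

Let incr_ge0 k : (0 : R) <= k%:R / N.+1%:R.
Proof. by rewrite divr_ge0. Qed.

Let incr_le k : (k%:R / N.+1%:R : R) <= k.+1%:R / N.+1%:R.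
Proof. by rewrite ler_pM2r ?invr_gt0// ler_nat. Qed.

Let incr_length k : k.+1%:R / N.+1%:R - k%:R / N.+1%:R = N.+1%:R^-1 :> R.
Proof. by rewrite -mulrBl -natrB ?leqnSn// subSnn mul1r. Qed.

Lemma grid_sum_law (a : nat -> 'rV[R]_m) n : centered_normal_law P
  (\sum_(k < n) N.+1%:R^-1 * (a k *m C *m (a k)^T) ord0 ord0) (grid_sum a n).
Proof.
elim: n => [|n IHn].
  have := bm_increment_law HW (lexx 0) (lexx 0) 0.
  rewrite !mul0mx mxE big_ord0; apply: centered_normal_law_ae => //.
    by rewrite /grid_sum; under eq_fun do rewrite big_ord0; exact: measurable_cst.
  apply: aeW => w; rewrite /grid_sum big_ord0 big1// => i _.
  by rewrite mxE mul0r.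
have := bm_increment_law HW (incr_ge0 n) (incr_le n) (a n).
rewrite incr_length -scalemxAr -scalemxAl mxE => lV.
rewrite big_ord_recr/=.
have -> : grid_sum a n.+1 = (fun w => grid_sum a n w +
    \sum_i a n ord0 i * (W (n.+1%:R / N.+1%:R) i w - W (n%:R / N.+1%:R) i w)).
  by apply/funext => w; rewrite /grid_sum big_ord_recr.
apply: (centered_normal_law_indep_sum HU IHn lV) => A B mA mB.
rewrite setIC muleC; apply: (bm_increment_indep HW (incr_ge0 n) (incr_le n)).
  pose G := [set E | exists2 i : 'I_m, [set: 'I_m] i & exists2 V : set R,
    measurable V & E = (fun w => W (n.+1%:R / N.+1%:R) i w
      - W (n%:R / N.+1%:R) i w) @^-1` V].
  have mV : measurable_fun (setT : set (g_sigma_algebraType G))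
      (fun w => \sum_i a n ord0 i * (W (n.+1%:R / N.+1%:R) i w
        - W (n%:R / N.+1%:R) i w)).
    apply: measurable_sum => i; apply: measurable_funM => // _ V mV.
    by rewrite setTI; apply: sub_sigma_algebra; exists i => //; exists V.
  by rewrite -[_ @^-1` _]setTI; exact: mV.
by rewrite -[_ @^-1` _]setTI; exact: grid_sum_past.
Qed.

Lemma gaussian_grid_sum J (a : J -> nat -> 'rV[R]_m) n :
  gaussian_family P (fun j => grid_sum (a j) n) (fun j j' =>
    \sum_(k < n) N.+1%:R^-1 * (a j k *m C *m (a j' k)^T) ord0 ord0).
Proof.
move=> s; have := grid_sum_law (fun k => \sum_(p <- s) p.1 *: a p.2 k) n.
have -> : lincomb (fun j => grid_sum (a j) n) s =
    grid_sum (fun k => \sum_(p <- s) p.1 *: a p.2 k) n.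
  apply/funext => w; rewrite /lincomb /grid_sum.
  under eq_bigr do rewrite big_distrr/=.
  rewrite exchange_big/=; apply: eq_bigr => k _.
  under eq_bigr do rewrite big_distrr/=.
  rewrite exchange_big/=; apply: eq_bigr => i _.
  rewrite summxE big_distrl/=; apply: eq_bigr => p _.
  by rewrite mxE mulrA.
congr (centered_normal_law _ _ _); rewrite /bilin.
under [RHS]eq_bigr do under eq_bigr do rewrite big_distrr/=.
under [RHS]eq_bigr do rewrite exchange_big/=.
rewrite exchange_big/=; apply: eq_bigr => k _.
rewrite (mulmx_form_sum C s (fun j => a j k)) big_distrr/=; apply: eq_bigr => p _.
by rewrite big_distrr/=; apply: eq_bigr => q _; rewrite mulrCA.
Qed.
End brownian_grid.

Section grid_index.
Context (R : realType).

(* The cap [N.+1 * N.+1] is reached for finitely many [N] only; it makes the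
   number of grid points bounded uniformly in [t]. *)
Definition grid_index (N : nat) (t : R) : nat :=
  minn (Num.truncn (`|t| * N.+1%:R)) (N.+1 * N.+1).

Lemma grid_index_le N t : (grid_index N t <= N.+1 * N.+1)%N.
Proof. exact: geq_minr. Qed.

Lemma cvg_minr (u v : nat -> R) a b : u @ \oo --> a -> v @ \oo --> b ->
  Num.min (u n) (v n) @[n --> \oo] --> Num.min a b.
Proof.
move=> ua vb; under eq_fun do rewrite minr_absE.
rewrite minr_absE; apply: cvgM; last exact: cvg_cst.
by apply: cvgB; [exact: cvgD|apply: cvg_norm; exact: cvgB].
Qed.

Lemma cvg_grid_index t :
  (grid_index N t)%:R / N.+1%:R @[N --> \oo] --> (`|t| : R).
Proof.
have t0 N : 0 <= `|t| * N.+1%:R by rewrite mulr_ge0.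
apply: (@squeeze_cvgr _ _ _ _ (fun N => `|t| - N.+1%:R^-1) (fun=> `|t|)).
- exists (Num.truncn `|t|) => // N /= tN.
  have -> : grid_index N t = Num.truncn (`|t| * N.+1%:R).
    apply/minn_idPl; rewrite truncn_le_nat.
    apply: (@lt_le_trans _ _ (N.+1%:R * N.+1%:R)).
      rewrite ltr_pM2r ?ltr0n//; apply: lt_le_trans (truncnS_gt _) _.
      by rewrite ler_nat.
    by rewrite -natrM ler_nat.
  have /andP[lo hi] := truncn_itv (t0 N).
  rewrite ler_pdivrMr ?ltr0n// lo andbT ler_pdivlMr ?ltr0n// mulrBl mulVf//.
  by rewrite lerBlDr natr1 ltW.
- rewrite -[X in _ --> X]subr0; apply: cvgB; first exact: cvg_cst.
  exact: cvg_harmonic.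
- exact: cvg_cst.
Qed.

Lemma cvg_grid_index_min t u :
  (minn (grid_index N t) (grid_index N u))%:R / N.+1%:R @[N --> \oo]
  --> (Num.min `|t| `|u| : R).
Proof.
under eq_fun do rewrite natr_min minr_pMl ?invr_ge0//.
by apply: cvg_minr; exact: cvg_grid_index.
Qed.

End grid_index.

Section simple_integrals.
Context (R : realType) d (T : measurableType d) (P : probability T R)
  (m : nat) (C : 'M[R]_m) (W : R -> 'I_m -> T -> R).
Hypothesis HW : brownian_motion P C W.
Context d0 (T0 : measurableType d0) (P0 : probability T0 R) (U : R -> T0 -> R).
Hypothesis HU : standard_brownian_motion P0 U.

Lemma gaussian_simple_integral N J (c : J -> nat -> R) (u : J -> 'rV[R]_m)
    (b : J -> nat) n : (forall j, (b j <= n)%N) ->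
  gaussian_family P
    (fun j w => \sum_(k < b j) c j k * \sum_i u j ord0 i * grid_incr W N k i w)
    (fun j j' => (u j *m C *m (u j')^T) ord0 ord0 *
       (N.+1%:R^-1 * \sum_(k < minn (b j) (b j')) c j k * c j' k)).
Proof.
move=> bn; pose a j k := (if (k < b j)%N then c j k else 0) *: u j.
apply: eq_gaussian_family (gaussian_grid_sum HW HU N a n) => [j w|j j'].
  pose g k := c j k * \sum_i u j ord0 i * grid_incr W N k i w.
  rewrite /grid_sum (big_ord_widen n g (bn j)) [RHS]big_mkcond/=.
  apply: eq_bigr => k _; rewrite /g /a; case: ifP => _.
    by rewrite big_distrr/=; apply: eq_bigr => i _; rewrite mxE mulrA.
  by rewrite big1// => i _; rewrite scale0r mxE mul0r.
have bn' : (minn (b j) (b j') <= n)%N by rewrite geq_min bn.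
rewrite (big_ord_widen n (fun k => c j k * c j' k) bn').
rewrite [X in _ = _ * (_ * X)]big_mkcond/= mulrCA !big_distrr/=.
apply: eq_bigr => k _; rewrite /a leq_min linearZ/= -scalemxAr -!scalemxAl !mxE.
by case: ifP; case: ifP => _ _ /=; ring.
Qed.

End simple_integrals.

(* A Brownian motion indexed by the whole line through [t |-> `|t|], whose
   paths are all continuous and start at 0, not only almost all of them. *)
Record regular_brownian (R : realType) d (T : measurableType d)
    (P : probability T R) (m : nat) (C : 'M[R]_m) (W : R -> 'I_m -> T -> R)
    : Prop := {
  rb_gaussian : gaussian_family P (fun k : R * 'I_m => W k.1 k.2)
    (fun k l => Num.min `|k.1| `|l.1| * C k.2 l.2);
  rb_start : forall i w, W 0 i w = 0;
  rb_continuous : forall i w, continuous (fun t => W t i w)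
}.

Section regularization.
Context (R : realType) d0 (T0 : measurableType d0) (P0 : probability T0 R)
  (U : R -> T0 -> R).
Hypothesis HU : standard_brownian_motion P0 U.

Lemma brownian_regularization d (T : measurableType d) (P : probability T R)
    (m : nat) (C : 'M[R]_m) (W : R -> 'I_m -> T -> R) :
  brownian_motion P C W -> exists W', regular_brownian P C W' /\
    {ae P, forall w, forall t i, 0 <= t -> W' t i w = W t i w}.
Proof.
move=> HW.
have [N [mN N0 subN]] : {ae P, forall w, (forall i, W 0 i w = 0) /\
    forall i, {within `[0, +oo[, continuous (fun t => W t i w)}}.
  exact: filterI (bm_start HW) (bm_continuous HW).
have goodN w : ~ N w -> (forall i, W 0 i w = 0) /\
    forall i, {within `[0, +oo[, continuous (fun t => W t i w)}.
  by move=> Nw; apply: contrapT => bad; apply: Nw; exact: subN.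
have aeN : {ae P, forall w, ~ N w}.
  by exists N; split => // w /= /contrapT.
pose W' (t : R) i w := W `|t| i w * \1_(~` N) w.
have W'in w t i : N w -> W' t i w = 0.
  by move=> Nw; rewrite /W' indicE memNset ?mulr0//; exact.
have W'out w t i : ~ N w -> W' t i w = W `|t| i w.
  by move=> Nw; rewrite /W' indicE mem_set ?mulr1.
have mW' t i : measurable_fun setT (W' t i).
  apply: measurable_funM; first exact: (bm_measurable HW).
  by apply: measurable_indic; exact: measurableC.
exists W'; split; last first.
  by apply: filterS aeN => w Nw t i t0; rewrite W'out// ger0_norm.
split.
- pose b n (k : R * 'I_m) := grid_index n k.1.
  have gY n := @gaussian_simple_integral _ _ _ _ _ _ _ HW _ _ _ _ HU n _
    (fun _ _ => 1) (fun k => delta_mx ord0 k.2) (b n) (n.+1 * n.+1)%N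
    (fun k => grid_index_le n k.1).
  apply: (gaussian_family_limit HU gY) => [k|k|k l]; first exact: mW'.
  + apply: filterS aeN => w Nw; have [W0 cW] := goodN w Nw.
    rewrite W'out//.
    have E n : \sum_(j < b n k) 1 * \sum_i (delta_mx ord0 k.2 : 'rV[R]_m) ord0 i
        * grid_incr W n j i w = W ((b n k)%:R / n.+1%:R) k.2 w.
      under eq_bigr => j _.
        rewrite mul1r (bigD1 k.2)//= mxE !eqxx mul1r big1 ?addr0; first over.
        by move=> i /negPf ik; rewrite mxE ik andbF mul0r.
      rewrite -(big_mkord xpredT (fun j => grid_incr W n j k.2 w)).
      by rewrite telescope_sumr// mul0r W0 subr0.
    under eq_fun do rewrite E.
    have -> : (fun n => W ((b n k)%:R / n.+1%:R) k.2 w) =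
        (fun t : R => W `|t| k.2 w) \o (fun n => (b n k)%:R / n.+1%:R).
      by apply/funext => n; rewrite /= ger0_norm// divr_ge0.
    rewrite -[X in W X]normr_id.
    apply: (continuous_cvg _ (continuous_comp_norm (cW k.2) (x := `|k.1|))).
    exact: cvg_grid_index.
  + under eq_fun do
      rewrite -rowE trmx_delta -colE !mxE mul1r sumr_const card_ord mulrC (mulrC _^-1).
    by apply: cvgM; [exact: cvg_grid_index_min|exact: cvg_cst].
- move=> i w; have [Nw|Nw] := pselect (N w); first exact: W'in.
  by rewrite W'out// normr0; exact: (goodN w Nw).1.
- move=> i w; have [Nw|Nw] := pselect (N w).
    by under eq_fun do rewrite W'in//; exact: cst_continuous.
  under eq_fun do rewrite W'out//.
  exact: continuous_comp_norm ((goodN w Nw).2 i).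
Qed.

End regularization.

Lemma mulmx_formE (R : realType) (m : nat) (C : 'M[R]_m) (a b : 'rV[R]_m) :
  (a *m C *m b^T) ord0 ord0 =
  \sum_i \sum_j a ord0 i * b ord0 j * C i j.
Proof.
rewrite mxE exchange_big/=; apply: eq_bigr => j _.
rewrite !mxE big_distrl/=; apply: eq_bigr => i _.
by rewrite mulrAC.
Qed.

Lemma gaussian_family_vector (R : realType) d (T : measurableType d)
    (P : probability T R) (m : nat) (C : 'M[R]_m) (Y : 'I_m -> T -> R) :
  gaussian_family P Y C -> centered_gaussian_vector P C Y.
Proof.
move=> gY a; have := gY [seq (a ord0 i, i) | i <- index_enum 'I_m].
congr (centered_normal_law _ _ _); last first.
  by apply/funext => w; rewrite /lincomb big_map.
rewrite mulmx_formE /bilin big_map; apply: eq_bigr => i _.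
by rewrite big_map.
Qed.

Section regular_brownian_motion.
Context (R : realType) d0 (T0 : measurableType d0) (P0 : probability T0 R)
  (U : R -> T0 -> R).
Hypothesis HU : standard_brownian_motion P0 U.

Lemma regular_brownian_motion d (T : measurableType d) (P : probability T R)
    (m : nat) (C : 'M[R]_m) (W : R -> 'I_m -> T -> R) :
  regular_brownian P C W -> brownian_motion P C W.
Proof.
move=> HW; have gW := rb_gaussian HW.
pose incr s t i w := W t i w - W s i w.
pose ci s t (i : 'I_m) : seq (R * (R * 'I_m)) := [:: (1, (t, i)); (-1, (s, i))].
have ciE s t i w : lincomb (fun k => W k.1 k.2) (ci s t i) w = incr s t i w.
  by rewrite /lincomb /ci big_cons big_seq1/= mul1r mulN1r.
split.
- by move=> t i _; exact: (gaussian_family_measurable gW (t, i)).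
- by apply: aeW => w i; rewrite (rb_start HW).
- move=> s t s0 st; have t0 := le_trans s0 st; apply: gaussian_family_vector.
  apply: eq_gaussian_family (gaussian_family_subst gW (ci s t)) => [i w|i j].
    exact: ciE.
  rewrite /bilin /ci !big_cons !big_nil/= !ger0_norm// !minxx.
  by rewrite (min_idPl st) (min_idPr st) mxE; ring.
- move=> s t s0 st; have t0 := le_trans s0 st.
  pose c (u : 'I_m + R * 'I_m) : seq (R * (R * 'I_m)) :=
    match u with inl i => ci s t i | inr k => [:: (1, k)] end.
  apply: (gaussian_independent HU (Y1 := incr s t) (Y2 := fun k => W k.1 k.2)).
    apply: eq_gaussian_family (gaussian_family_subst gW c); last by [].
    move=> [i|k] w; first exact: ciE.
    by rewrite /lincomb big_seq1 mul1r.
  move=> i k _ /= /andP[k0 ks]; have kt := le_trans ks st.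
  rewrite /bilin /c /ci !big_cons !big_nil/= !ger0_norm//.
  by rewrite !(min_idPr ks, min_idPr kt, min_idPl ks, min_idPl kt); split; ring.
- apply: aeW => w i; apply: continuous_subspaceT.
  exact: (rb_continuous HW).
Qed.

Lemma regular_standard_brownian_exists (m : nat) :
  exists (d : measure_display) (T : measurableType d) (P : probability T R)
    (W : R -> 'I_m -> T -> R), regular_brownian P 1%:M W.
Proof.
have [V [HV _]] := brownian_regularization HU HU.
have gV := rb_gaussian HV.
elim: m => [|m [d [T [P [W HW]]]]].
  exists d0, T0, P0, (fun _ _ _ => 0); split => //; last by move=> [].
  apply: eq_gaussian_family (gaussian_family_subst gV (fun=> [::])).
    by move=> [? []].
  by move=> [? []].
have gW := rb_gaussian HW.
pose W' (t : R) (i : 'I_m.+1) (w : T * T0) :=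
  if unlift ord0 i is Some j then W t j w.1 else V t ord0 w.2.
exists _, _, (P \x P0)%E, W'; split.
- pose c1 (k : R * 'I_m.+1) : seq (R * (R * 'I_m)) :=
    if unlift ord0 k.2 is Some j then [:: (1, (k.1, j))] else [::].
  pose c2 (k : R * 'I_m.+1) : seq (R * (R * 'I_1)) :=
    if unlift ord0 k.2 is Some j then [::] else [:: (1, (k.1, ord0))].
  apply: eq_gaussian_family (gaussian_family_product_sum HU
    (gaussian_family_subst gW c1) (gaussian_family_subst gV c2)).
  + move=> [t i] w; rewrite /lincomb /c1 /c2 /W' /=.
    by case: unliftP => [j|] _; rewrite big_nil big_seq1 mul1r ?addr0 ?add0r.
  + move=> [t i] [u j]; rewrite /bilin /c1 /c2 /=.
    case: unliftP => [i' ->|->]; case: unliftP => [j' ->|->];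
      rewrite ?big_seq1 ?big_nil ?mul1r ?addr0 ?add0r !mxE ?mulr0//.
- by move=> i w; rewrite /W'; case: unliftP => [j|] _; rewrite (rb_start HW, rb_start HV).
- move=> i w; rewrite /W'; case: unliftP => [j|] _;
    [exact: (rb_continuous HW)|exact: (rb_continuous HV)].
Qed.

End regular_brownian_motion.

(** * Square roots of nonnegative symmetric matrices *)

Section psd_square_root.
Context (R : realType).
Notation toC := (real_complex R).

Lemma polynomial_interpolation (s : seq R) (f : R -> R) :
  exists q : {poly R}, forall x, x \in s -> q.[x] = f x.
Proof.
elim: s => [|x s [q qs]]; first by exists 0.
have [xs|xs] := boolP (x \in s).
  by exists q => y; rewrite inE => /predU1P[->|]; exact: qs.
pose p := \prod_(y <- s) ('X - y%:P).
have px0 : p.[x] != 0 by rewrite -[_ == 0]/(root p x) root_prod_XsubC.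
exists (q + ((f x - q.[x]) / p.[x]) *: p) => y.
rewrite inE hornerD hornerZ => /predU1P[->|ys].
  by rewrite divfK// addrC subrK.
have /rootP -> : root p y by rewrite root_prod_XsubC.
by rewrite mulr0 addr0 qs.
Qed.

Lemma trmx_horner_mx m (C : 'M[R]_m.+1) (q : {poly R}) :
  C^T = C -> (horner_mx C q)^T = horner_mx C q.
Proof.
move=> CT; elim/poly_ind: q => [|q c IHq]; first by rewrite rmorph0 trmx0.
rewrite rmorphD rmorphM/= horner_mx_X horner_mx_C linearD/= tr_scalar_mx.
congr (_ + _); rewrite -[_ * C]/(_ *m C) trmx_mul CT IHq.
exact/esym/comm_horner_mx.
Qed.

Lemma psd_eigenvalue_ge0 m (C : 'M[R]_m) l :
  psd_mx C -> eigenvalue C l -> 0 <= l.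
Proof.
move=> [_ C0] /eigenvalueP[v vC v0].
have sq_ge0 : 0 <= (v *m v^T) ord0 ord0.
  by rewrite mxE sumr_ge0// => i _; rewrite mxE -expr2 sqr_ge0.
have sq_neq0 : (v *m v^T) ord0 ord0 != 0.
  apply: contra_neq v0; rewrite mxE => /eqP.
  rewrite psumr_eq0 => [/allP h|i _]; last by rewrite mxE -expr2 sqr_ge0.
  apply/rowP => i; have := h i (mem_index_enum i).
  by rewrite !mxE -expr2 sqrf_eq0 => /eqP.
have := C0 v^T; rewrite trmxK vC -scalemxAl mxE.
by rewrite pmulr_lge0// lt_neqAle eq_sym sq_neq0.
Qed.

Lemma psd_mx_sqrt m (C : 'M[R]_m) : psd_mx C -> exists Q, is_sqrt_mx C Q.
Proof.
case: m C => [|m] C psdC.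
  by exists C; split => //; apply/matrixP => -[].
have [CT _] := psdC.
have [A AC] : exists A : 'M[R[i]]_m.+1, A = map_mx toC C by exists (map_mx toC C).
have hA : A \is hermsymmx.
  apply: realsym_hermsym.
    apply/is_hermitianmxP; rewrite expr0 scale1r; apply/matrixP => i j.
    by rewrite AC !mxE -{1}CT mxE.
  apply/mxOverP => i j; rewrite AC mxE; apply/complex_realP; by exists (C i j).
have /orthomx_spectralP AE := hermitian_normalmx hA.
have /mxOverP realD := hermitian_spectral_diag_real hA.
set V := spectralmx A in AE; set D := spectral_diag A in AE realD.
have uV : V \in unitmx by exact: spectral_unit.
pose l i := complex.Re (D ord0 i).
have lD i : toC (l i) = D ord0 i by apply: RRe_real; exact: realD.
have l0 i : 0 <= l i.
  apply: (psd_eigenvalue_ge0 psdC).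
  suff : eigenvalue A (toC (l i)).
    by rewrite !eigenvalue_root_char AC -map_char_poly fmorph_root.
  rewrite lD; apply/eigenvalueP; exists (row i V).
    rewrite {1}AE -row_mul !mulmxA mulmxV// mul1mx.
    by rewrite row_mul row_diag_mx -scalemxAl -rowE.
  apply/eqP => Vi; have := uV; rewrite -row_free_unit => /row_freeP[V' VV'].
  have := congr1 (row i) VV'; rewrite row_mul Vi mul0mx row1 => /rowP/(_ i).
  by rewrite !mxE !eqxx => /eqP; rewrite eq_sym oner_eq0.
have [q qE] := polynomial_interpolation [seq l i | i <- index_enum 'I_m.+1]
  (fun x => Num.sqrt (Num.sqrt x)).
have qlE i : q.[l i] = Num.sqrt (Num.sqrt (l i)).
  by apply: qE; apply: map_f; exact: mem_index_enum.
pose B := horner_mx C q.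
have BT : B^T = B by exact: trmx_horner_mx.
exists (B *m B); split; [split|].
- by rewrite trmx_mul BT.
- move=> x; rewrite -{1}BT mulmxA -trmx_mul -mulmxA mxE sumr_ge0// => i _.
  by rewrite mxE -expr2 sqr_ge0.
apply: (map_mx_inj (f := toC)).
have -> : B *m B *m (B *m B) = horner_mx C (q ^+ 4).
  by rewrite rmorphXn/= -/B !exprSr expr0 mul1r -[LHS]/((B * B) * (B * B)) mulrA.
rewrite map_horner_mx -AC [in LHS]AE (horner_mx_uconjC _ _ uV) horner_mx_diag.
suff -> : map_mx (horner (map_poly toC (q ^+ 4))) D = D by exact: esym AE.
apply/rowP => i.
rewrite mxE -lD horner_map/= horner_exp qlE.
by rewrite (exprM _ 2 2) !sqr_sqrtr// sqrtr_ge0.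
Qed.

End psd_square_root.

(** * Riemann sums and the Ornstein-Uhlenbeck equation *)

Section riemann_sums.
Context (R : realType).

Lemma uniform_continuity (f : R -> R) (a b e : R) : continuous f -> 0 < e ->
  exists2 r, 0 < r & forall x y, x \in `[a, b] -> `|x - y| < r -> `|f x - f y| < e.
Proof.
move=> cf e0; have /compact_near_coveringP K := @segment_compact R a b.
have [|r /= r0 Hr] := K R (0^'+) (fun r x => forall y, `|x - y| < r -> `|f x - f y| < e).
  move=> x _; have e2 : 0 < e / 2 by rewrite divr_gt0.
  have /cvgrPdist_lt /(_ _ e2) [r /= r0 Hr] := cf x.
  exists ([set x' | `|x - x'| < r / 2], [set s | s < r / 2]) => /=.
    split; first by exists (r / 2) => //=; rewrite divr_gt0.
    by apply: nbhs_right_lt; rewrite divr_gt0.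
  move=> [x' s] /= [xx' sr] y x'y.
  have h1 : `|f x - f x'| < e / 2 by apply: Hr => /=; apply: lt_trans xx' _; lra.
  have h2 : `|f x - f y| < e / 2.
    apply: Hr => /=; apply: le_lt_trans (ler_distD x' _ _) _.
    by move: xx' sr x'y; lra.
  by apply: le_lt_trans (ler_distD (f x) _ _) _; rewrite distrC; lra.
exists (r / 2); first by rewrite divr_gt0.
move=> x y xab xy; apply: (Hr (r / 2)) => //=.
  by rewrite sub0r normrN gtr0_norm ?divr_gt0//; lra.
by rewrite divr_gt0.
Qed.

Lemma cvg_riemann_sum (f G : R -> R) (n : nat -> nat) (t : R) :
  continuous f -> (forall x : R, -1 < x -> is_derive x (1 : R) G (f x)) -> G 0 = 0 ->
  0 <= t -> (forall N, (n N)%:R / N.+1%:R <= t) ->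
  (n N)%:R / N.+1%:R @[N --> \oo] --> t ->
  N.+1%:R^-1 * \sum_(k < n N) f (k.+1%:R / N.+1%:R) @[N --> \oo] --> G t.
Proof.
move=> cf dG G0 t0 nt cn.
have cG (x : R) : -1 < x -> {for x, continuous G}.
  by move=> x1; apply/differentiable_continuous/derivable1_diffP; have [] := dG x x1.
have cGn : G ((n N)%:R / N.+1%:R) @[N --> \oo] --> G t.
  have ct := cG t (lt_le_trans (ltrN10 R) t0).
  exact: (continuous_cvg _ ct cn).
rewrite -[X in _ --> X]add0r.
have -> : (fun N => N.+1%:R^-1 * \sum_(k < n N) f (k.+1%:R / N.+1%:R)) =
  (fun N => (N.+1%:R^-1 * \sum_(k < n N) f (k.+1%:R / N.+1%:R)
     - G ((n N)%:R / N.+1%:R)) + G ((n N)%:R / N.+1%:R)).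
  by apply/funext => N; rewrite subrK.
apply: cvgD cGn; apply/cvgrPdist_lt => e e0.
have e1 : 0 < e / (t + 1) by rewrite divr_gt0//; lra.
have [r r0 Hr] := uniform_continuity 0 t cf e1.
have /cvgrPdist_lt/(_ _ r0) [N0 _ HN0] := @cvg_harmonic R.
exists N0 => // N NN0; rewrite sub0r normrN.
have h0 : 0 < N.+1%:R^-1 :> R by rewrite invr_gt0.
have hr : N.+1%:R^-1 < r.
  by have := HN0 N NN0; rewrite /= sub0r normrN gtr0_norm.
set h := N.+1%:R^-1 in h0 hr *.
have -> : G ((n N)%:R / N.+1%:R) =
    \sum_(k < n N) (G (k.+1%:R * h) - G (k%:R * h)).
  rewrite -(big_mkord xpredT (fun k => G (k.+1%:R * h) - G (k%:R * h))).
  by rewrite telescope_sumr// mul0r G0 subr0.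
rewrite big_distrr/= -sumrB; apply: le_lt_trans (ler_norm_sum _ _ _) _.
apply: (@le_lt_trans _ _ (\sum_(k < n N) h * (e / (t + 1)))); last first.
  rewrite sumr_const card_ord -mulr_natl mulrA.
  apply: (@le_lt_trans _ _ (t * (e / (t + 1)))).
    by rewrite ler_wpM2r// ?ltW//; exact: nt.
  rewrite mulrA ltr_pdivrMr; last by lra.
  by nra.
apply: ler_sum => k _.
have kh0 : 0 <= k%:R * h by rewrite mulr_ge0// ltW.
have khlt : k%:R * h < k.+1%:R * h by rewrite ltr_pM2r// ltr_nat.
have dGk (x : R) : x \in `](k%:R * h), (k.+1%:R * h)[ -> is_derive x (1 : R) G (f x).
  by rewrite in_itv/= => /andP[x0 _]; apply: dG; lra.
have [|c /[!in_itv]/= /andP[c1 c2] ->] := MVT khlt dGk.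
  apply: continuous_in_subspaceT => x /[!inE]/= /[!in_itv]/= /andP[x0 _].
  by apply: cG; lra.
have -> : k.+1%:R * h - k%:R * h = h by rewrite -natr1; ring.
rewrite (mulrC (f c)) -mulrBr normrM gtr0_norm// ler_pM2l//.
apply/ltW/Hr.
  rewrite in_itv/= (le_trans kh0 (ltW khlt))/=.
  apply: le_trans (nt N); rewrite ler_pM2r// ler_nat; exact: ltn_ord.
have : k.+1%:R * h - k%:R * h = h by rewrite -natr1; ring.
by move=> E; rewrite ger0_norm; lra.
Qed.

Lemma cvg_exp_slope (c : R) : 0 <= c ->
  N.+1%:R * (1 - expR (- (c / N.+1%:R))) @[N --> \oo] --> (c : R).
Proof.
move=> c0; apply: (@squeeze_cvgr _ _ _ _ (fun N => c / (1 + c * N.+1%:R^-1)) (fun=> c)).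
- apply: nearW => N; have N0 : 0 < N.+1%:R :> R by rewrite ltr0n.
  have u0 : 0 <= c / N.+1%:R by rewrite divr_ge0// ltW.
  have cE : c = N.+1%:R * (c / N.+1%:R) by rewrite mulrCA divff ?mulr1// gt_eqF.
  set u := c / N.+1%:R in u0 cE *.
  have u1 : 0 < 1 + u by apply: lt_le_trans ltr01 _; rewrite lerDl.
  apply/andP; split.
    have e1 : expR (- u) <= (1 + u)^-1.
      by rewrite expRN lef_pV2 ?posrE ?expR_gt0 ?expR_ge1Dx.
    apply: (@le_trans _ _ (N.+1%:R * (1 - (1 + u)^-1))).
      rewrite {1}cE le_eqVlt; apply/orP; left; apply/eqP; field.
      by rewrite gt_eqF.
    by rewrite ler_pM2l// lerD2l lerN2.
  rewrite [leRHS]cE ler_pM2l// lerBlDr -lerBlDl.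
  exact: expR_ge1Dx.
- rewrite -[X in _ --> X]divr1; apply: cvgM; first exact: cvg_cst.
  apply: cvgV => //; rewrite -[X in _ --> X]addr0; apply: cvgD; first exact: cvg_cst.
  rewrite -[X in _ --> X](mulr0 c); apply: cvgM; first exact: cvg_cst.
  exact: cvg_harmonic.
- exact: cvg_cst.
Qed.

End riemann_sums.

Section ou_path.
Context (R : realType).

(* Integrating from [-1] makes the primitive differentiable at [0] too. *)
Definition primitive (f : R -> R) (t : R) : R :=
  \int[lebesgue_measure]_(s in `[-1, t]) f s - \int[lebesgue_measure]_(s in `[-1, 0]) f s.

Lemma is_derive_primitive (f : R -> R) (t : R) : continuous f -> -1 < t ->
  is_derive t (1 : R) (primitive f) (f t).
Proof.
move=> cf t1.
have tu : t < t + 1 by rewrite ltrDl.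
have intf : lebesgue_measure.-integrable `[-1, t + 1] (EFin \o f).
  apply: continuous_compact_integrable; first exact: segment_compact.
  exact: continuous_subspaceT.
have [|dF FE] := continuous_FTC1 tu intf _ (cf t).
  by rewrite /= lte_fin.
have dF' : is_derive t (1 : R)
    (fun x : R => \int[lebesgue_measure]_(s in `[-1, x]) f s) (f t).
  by apply: DeriveDef; [exact: dF|rewrite -FE derive1E].
rewrite -[f t]subr0; exact: is_deriveB.
Qed.

Lemma primitive0 (f : R -> R) : primitive f 0 = 0.
Proof. exact: subrr. Qed.

Variables (g y0 : R) (x : R -> R).
Hypotheses (g0 : 0 < g) (cx : continuous x) (x0 : x 0 = 0).

Let f (r : R) := expR (g * r) * x r.

(* Variation of constants for [dy = - g y dt + dx], integrated by parts so that
   only the continuous path [x] is integrated. *)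
Definition ou_path (t : R) : R :=
  expR (- (g * t)) * (y0 - g * primitive f t) + x t.

Let cf : continuous f.
Proof.
move=> r; apply: cvgM; last exact: cx.
apply: continuous_comp; last exact: continuous_expR.
by apply: cvgM; [exact: cvg_cst|exact: cvg_id].
Qed.

Let z (t : R) := expR (- (g * t)) * (y0 - g * primitive f t).

Let dz (t : R) : -1 < t -> is_derive t (1 : R) z (- g * ou_path t).
Proof.
move=> t1; have dG := is_derive_primitive cf t1.
have dL : is_derive t (1 : R) (fun s : R => - g * s) (- g).
  apply: (is_derive_eq (is_deriveZ (- g) (is_derive_id t (1 : R)))).
  by rewrite /GRing.scale/= mulr1.
have dE : is_derive t (1 : R) (fun s : R => expR (- (g * s))) (- g * expR (- (g * t))).
  rewrite (_ : (fun s => _) = expR \o (fun s : R => - g * s)); last first.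
    by apply/funext => s; rewrite /= mulNr.
  apply: (is_derive_eq (is_derive1_comp (is_derive_expR _) dL)).
  by rewrite mulrC (mulNr g t).
have dH : is_derive t (1 : R) (fun s => y0 - g * primitive f s) (- g * f t).
  rewrite (_ : (fun s => _) = cst y0 + (- g) \*: primitive f); last first.
    by apply/funext => s; rewrite -mulNr.
  apply: (is_derive_eq (is_deriveD (is_derive_cst y0 t (1 : R)) (is_deriveZ (- g) dG))).
  by rewrite add0r.
apply: (is_derive_eq (is_deriveM dE dH)).
rewrite /GRing.scale/= /ou_path /f expRN; field.
by rewrite gt_eqF// expR_gt0.
Qed.

Let cz (t : R) : -1 < t -> {for t, continuous z}.
Proof.
by move=> t1; apply/differentiable_continuous/derivable1_diffP; have [] := dz t1.
Qed.

Lemma ou_path_continuous (t : R) : -1 < t -> {for t, continuous ou_path}.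
Proof. by move=> t1; apply: cvgD; [exact: cz|exact: cx]. Qed.

Lemma ou_path_start : ou_path 0 = y0.
Proof. by rewrite /ou_path primitive0 x0 !mulr0 subr0 oppr0 expR0 mul1r addr0. Qed.

Lemma ou_path_equation (t : R) : 0 <= t ->
  ou_path t = y0 + \int[lebesgue_measure]_(s in `[0, t]) (- g * ou_path s) + x t.
Proof.
rewrite le_eqVlt => /predU1P[<-|t0].
  by rewrite set_itv1 Rintegral_set1 x0 !addr0 ou_path_start.
have cy : {within `[0, t], continuous (fun s => - g * ou_path s)}.
  apply: continuous_in_subspaceT => s /[!inE]/= /[!in_itv]/= /andP[s0 _].
  apply: cvgM; first exact: cvg_cst.
  by apply: ou_path_continuous; lra.
have zLR : derivable_oo_LRcontinuous z 0 t.
  split.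
  - by move=> s /[!in_itv]/= /andP[s0 _]; have [] := dz (lt_trans (ltrN10 R) s0).
  - by apply: cvg_at_right_filter; apply: cz; lra.
  - by apply: cvg_at_left_filter; apply: cz; lra.
have zE : {in `]0, t[, z^`()%classic =1 (fun s => - g * ou_path s)}.
  move=> s /[!in_itv]/= /andP[s0 _]; rewrite derive1E.
  by have [_ ->] := dz (lt_trans (ltrN10 R) s0).
rewrite /Rintegral (continuous_FTC2 t0 cy zLR zE)/=.
have -> : z 0 = y0 by rewrite /z primitive0 !mulr0 subr0 oppr0 expR0 mul1r.
by rewrite /ou_path /z; ring.
Qed.

Lemma cvg_ou_path (n : nat -> nat) (t : R) :
  0 <= t -> (forall N, (n N)%:R / N.+1%:R <= t) ->
  (n N)%:R / N.+1%:R @[N --> \oo] --> t ->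
  expR (- (g * t)) * (y0 + \sum_(k < n N) expR (g * (k%:R / N.+1%:R)) *
    (x (k.+1%:R / N.+1%:R) - x (k%:R / N.+1%:R))) @[N --> \oo] --> ou_path t.
Proof.
move=> t0 nt cn.
have sumE N : \sum_(k < n N) expR (g * (k%:R / N.+1%:R)) *
      (x (k.+1%:R / N.+1%:R) - x (k%:R / N.+1%:R)) =
    f ((n N)%:R / N.+1%:R) - N.+1%:R * (1 - expR (- (g / N.+1%:R))) *
      (N.+1%:R^-1 * \sum_(k < n N) f (k.+1%:R / N.+1%:R)).
  have -> : f ((n N)%:R / N.+1%:R) =
      \sum_(k < n N) (f (k.+1%:R / N.+1%:R) - f (k%:R / N.+1%:R)).
    rewrite -(big_mkord xpredT (fun k => f (k.+1%:R / N.+1%:R) - f (k%:R / N.+1%:R))).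
    by rewrite telescope_sumr// mul0r /f x0 mulr0 subr0.
  rewrite mulrA (mulrAC N.+1%:R) divff// mul1r big_distrr/= -sumrB.
  apply: eq_bigr => k _; rewrite /f.
  have -> : g * (k.+1%:R / N.+1%:R) = g * (k%:R / N.+1%:R) + g / N.+1%:R.
    by rewrite -natr1 mulrDl mul1r mulrDr.
  rewrite expRD expRN; field.
  by rewrite gt_eqF// expR_gt0.
have cG := cvg_riemann_sum cf (fun s => is_derive_primitive cf) (primitive0 f) t0 nt cn.
have cfn : f ((n N)%:R / N.+1%:R) @[N --> \oo] --> f t.
  exact: (continuous_cvg _ (cf (x := t)) cn).
under eq_fun do rewrite sumE.
have -> : ou_path t = expR (- (g * t)) * (y0 + (f t - g * primitive f t)).
  rewrite /ou_path /f expRN; field.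
  by rewrite gt_eqF// expR_gt0.
apply: cvgM; first exact: cvg_cst.
apply: cvgD; first exact: cvg_cst.
by apply: cvgB cfn _; apply: cvgM cG; apply: cvg_exp_slope; exact: ltW.
Qed.

End ou_path.

(** * Ornstein-Uhlenbeck processes *)

Section gaussian_supplements.
Context (R : realType) d0 (T0 : measurableType d0) (P0 : probability T0 R)
  (U : R -> T0 -> R).
Hypothesis HU : standard_brownian_motion P0 U.

Lemma gaussian_family_ae d (T : measurableType d) (P : probability T R) I
    (Y Y' : I -> T -> R) K : (forall i, measurable_fun setT (Y' i)) ->
  (forall i, {ae P, forall w, Y i w = Y' i w}) ->
  gaussian_family P Y K -> gaussian_family P Y' K.
Proof.
move=> mY' YY' gY; apply: (gaussian_family_limit HU (Y_ := fun=> Y) (K_ := fun=> K)).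
- by [].
- exact: mY'.
- by move=> i; apply: filterS (YY' i) => w ->; exact: cvg_cst.
- by move=> i j; exact: cvg_cst.
Qed.

Lemma gaussian_family_product d1 (T1 : measurableType d1) (P1 : probability T1 R)
    d2 (T2 : measurableType d2) (P2 : probability T2 R) I1 I2
    (Y1 : I1 -> T1 -> R) (Y2 : I2 -> T2 -> R) K1 K2 :
  gaussian_family P1 Y1 K1 -> gaussian_family P2 Y2 K2 ->
  gaussian_family (P1 \x P2)%E
    (sum_family (fun i w => Y1 i w.1) (fun j w => Y2 j w.2))
    (fun u v => match u, v with
                | inl i, inl i' => K1 i i'
                | inr j, inr j' => K2 j j'
                | _, _ => 0
                end).
Proof.
move=> g1 g2.
pose c1 (u : I1 + I2) : seq (R * I1) := if u is inl i then [:: (1, i)] else [::].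
pose c2 (u : I1 + I2) : seq (R * I2) := if u is inr j then [:: (1, j)] else [::].
apply: eq_gaussian_family (gaussian_family_product_sum HU
  (gaussian_family_subst g1 c1) (gaussian_family_subst g2 c2)).
  by move=> [i|j] w; rewrite /lincomb big_seq1 big_nil mul1r ?addr0 ?add0r.
by move=> [i|j] [i'|j']; rewrite /bilin ?big_seq1 ?big_nil ?mul1r ?addr0 ?add0r.
Qed.

Lemma brownian_covariance_ge0 d (T : measurableType d) (P : probability T R)
    m (C : 'M[R]_m) b : brownian_motion P C b ->
  forall x : 'cV[R]_m, 0 <= (x^T *m C *m x) ord0 ord0.
Proof.
move=> Hb x; have := bm_increment_law Hb (lexx 0) ler01 x^T.
by rewrite subr0 scale1r trmxK => -[].
Qed.

End gaussian_supplements.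

Section lamperti.
Context (R : realType) (g : R).
Hypothesis g0 : 0 < g.

Definition lamperti T m (b : R -> 'I_m -> T -> R) (t : R) (i : 'I_m) (w : T) : R :=
  expR (- (g * t)) / Num.sqrt (2 * g) * b (expR (2 * g * t)) i w.

Lemma ou_kernelE (t u : R) :
  expR (- (g * t)) * expR (- (g * u)) * expR (2 * g * Num.min t u) =
  expR (- (g * `|t - u|)).
Proof.
rewrite -!expRD; congr expR; rewrite minr_absE.
by field.
Qed.

Context d0 (T0 : measurableType d0) (P0 : probability T0 R) (U : R -> T0 -> R).
Hypothesis HU : standard_brownian_motion P0 U.

Lemma gaussian_lamperti d (T : measurableType d) (P : probability T R)
    m (C : 'M[R]_m) b : brownian_motion P C b ->
  gaussian_family P (fun k => lamperti b k.1 k.2)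
    (fun k l => expR (- (g * `|k.1 - l.1|)) / (2 * g) * C k.2 l.2).
Proof.
move=> Hb; have [b' [Hb' bb']] := brownian_regularization HU Hb.
have g2 : 0 < 2 * g by rewrite mulr_gt0.
apply: (@gaussian_family_ae _ _ _ _ _ HU _ _ _ _ (fun k => lamperti b' k.1 k.2)).
- move=> k; apply: measurable_funM => //; apply: (bm_measurable Hb).
  exact: expR_ge0.
- by move=> k; apply: filterS bb' => w bw; rewrite /lamperti bw// expR_ge0.
apply: eq_gaussian_family (gaussian_family_reindex (rb_gaussian Hb')
  (fun k : R * 'I_m => expR (- (g * k.1)) / Num.sqrt (2 * g))
  (fun k : R * 'I_m => (expR (2 * g * k.1), k.2))) => //.
move=> k l /=; rewrite !(ger0_norm (expR_ge0 _)) -ou_kernelE.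
have -> : Num.min (expR (2 * g * k.1)) (expR (2 * g * l.1)) =
    expR (2 * g * Num.min k.1 l.1).
  have [kl|lk] := leP k.1 l.1.
    by apply/min_idPl; rewrite ler_expR ler_pM2l.
  by apply/min_idPr; rewrite ler_expR ler_pM2l// ltW.
have s0 : Num.sqrt (2 * g) != 0 by rewrite gt_eqF// sqrtr_gt0.
have := sqr_sqrtr (ltW g2); rewrite expr2.
move: s0; move: (Num.sqrt _) (expR (2 * g * _)) => s e s0 <-.
by field.
Qed.

Lemma lamperti_continuous d (T : measurableType d) (P : probability T R)
    m (C : 'M[R]_m) b : brownian_motion P C b ->
  continuous_paths P [set: R] (lamperti b).
Proof.
move=> Hb; apply: filterS (bm_continuous Hb) => w cb i.
have cb' : continuous (fun t => b (expR (2 * g * t)) i w).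
  rewrite (_ : (fun t => _) =
      (fun t : R => b `|t| i w) \o (fun t => expR (2 * g * t))); last first.
    by apply/funext => s; rewrite /= ger0_norm// expR_ge0.
  move=> t; apply: continuous_comp; last exact: (continuous_comp_norm (cb i)).
  apply: continuous_comp; last exact: continuous_expR.
  by apply: cvgM; [exact: cvg_cst|exact: cvg_id].
apply: continuous_subspaceT => t; apply: cvgM; last exact: cb'.
apply: cvgM; last exact: cvg_cst.
apply: continuous_comp; last exact: continuous_expR.
by apply: cvgN; apply: cvgM; [exact: cvg_cst|exact: cvg_id].
Qed.

End lamperti.

Lemma cvg_exp_sum (R : realType) (c : R) (n : nat -> nat) (t : R) : 0 < c ->
  0 <= t -> (forall N, (n N)%:R / N.+1%:R <= t) ->
  (n N)%:R / N.+1%:R @[N --> \oo] --> t ->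
  N.+1%:R^-1 * \sum_(k < n N) expR (c * (k%:R / N.+1%:R)) @[N --> \oo]
  --> (expR (c * t) - 1) / c.
Proof.
move=> c0 t0 nt cn.
have cL : continuous (fun s : R => c * s).
  by move=> s; apply: cvgM; [exact: cvg_cst|exact: cvg_id].
have cf : continuous (fun s : R => expR (c * s)).
  by move=> s; apply: continuous_comp; [exact: cL|exact: continuous_expR].
have dG (s : R) : -1 < s ->
    is_derive s (1 : R) (fun s : R => (expR (c * s) - 1) / c) (expR (c * s)).
  move=> _.
  have dL : is_derive s (1 : R) (fun s : R => c * s) c.
    apply: (is_derive_eq (is_deriveZ c (is_derive_id s (1 : R)))).
    by rewrite /GRing.scale/= mulr1.
  have dE := is_deriveD (is_derive1_comp (is_derive_expR (c * s)) dL)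
    (is_derive_cst (- 1 : R) s (1 : R)).
  rewrite (_ : (fun _ => _) =
      c^-1 \*: (expR \o (fun s : R => c * s) + cst (- 1 : R))); last first.
    by apply/funext => r; rewrite mulrC.
  apply: (is_derive_eq (is_deriveZ c^-1 dE)).
  by rewrite /GRing.scale/=; field; rewrite gt_eqF.
have G0 : (expR (c * 0) - 1) / c = 0 by rewrite mulr0 expR0 subrr mul0r.
have := cvg_riemann_sum cf dG G0 t0 nt cn.
have cE : expR (- (c * N.+1%:R^-1)) @[N --> \oo] --> (1 : R).
  rewrite -[X in _ --> X]expR0; apply: continuous_cvg; first exact: continuous_expR.
  rewrite -[X in _ --> X]oppr0 -(mulr0 c); apply: cvgN.
  by apply: cvgM; [exact: cvg_cst|exact: cvg_harmonic].
move=> /(cvgM cE); rewrite mul1r; apply: cvg_trans; apply: near_eq_cvg.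
apply: nearW => N; rewrite /= mulrCA; congr (_ * _).
rewrite big_distrr/=; apply: eq_bigr => k _.
rewrite -expRD; congr expR; rewrite -natr1; ring.
Qed.

Section ornstein_uhlenbeck.
Context (R : realType) (g : R).
Hypothesis g0 : 0 < g.
Context d0 (T0 : measurableType d0) (P0 : probability T0 R) (U : R -> T0 -> R).
Hypothesis HU : standard_brownian_motion P0 U.

Section sde_solution.
Context d1 (T1 : measurableType d1) (P1 : probability T1 R)
  d2 (T2 : measurableType d2) (P2 : probability T2 R)
  (m : nat) (C Q : 'M[R]_m) (W : R -> 'I_m -> T1 -> R) (y : 'I_m -> T2 -> R).
Hypothesis HW : regular_brownian P1 1%:M W.
Hypothesis HQ : is_sqrt_mx C Q.
Hypothesis gy : gaussian_family P2 y (fun i j => C i j / (2 * g)).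

Definition noise_path (w : T1) (i : 'I_m) (t : R) : R :=
  \sum_(j < m) Q i j * W t j w.

Definition ou_solution (t : R) (i : 'I_m) (w : T1 * T2) : R :=
  ou_path g (y i w.2) (noise_path w.1 i) t.

Let noise_continuous w i : continuous (noise_path w i).
Proof.
move=> t; rewrite /continuous_at /noise_path.
apply: cvg_big => // [|j _]; first exact: add_continuous.
apply: cvgM; first exact: cvg_cst.
exact: (rb_continuous HW).
Qed.

Let noise_start w i : noise_path w i 0 = 0.
Proof. by rewrite /noise_path big1// => j _; rewrite (rb_start HW) mulr0. Qed.

Let approx N (k : R * 'I_m) (w : T1 * T2) : R :=
  \sum_(l < grid_index N k.1) (expR (- (g * `|k.1|)) * expR (g * (l%:R / N.+1%:R))) *
    (\sum_j row k.2 Q ord0 j * grid_incr W N l j w.1) +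
  expR (- (g * `|k.1|)) * y k.2 w.2.

Let grid_le N (t : R) : (grid_index N t)%:R / N.+1%:R <= `|t|.
Proof.
rewrite ler_pdivrMr ?ltr0n//.
apply: le_trans (_ : (Num.truncn (`|t| * N.+1%:R))%:R <= _).
  by rewrite ler_nat geq_minl.
by rewrite truncn_le mulr_ge0.
Qed.

Let cvg_approx k w : approx N k w @[N --> \oo] --> ou_solution `|k.1| k.2 w.
Proof.
have := cvg_ou_path (y0 := y k.2 w.2) g0 (@noise_continuous w.1 k.2)
  (noise_start w.1 k.2) (normr_ge0 k.1) (grid_le ^~ k.1) (@cvg_grid_index R k.1).
apply: cvg_trans; apply: near_eq_cvg; apply: nearW => N.
rewrite /= /approx mulrDr addrC; congr (_ + _).
rewrite big_distrr/=; apply: eq_bigr => l _; rewrite -mulrA; congr (_ * (_ * _)).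
rewrite /noise_path -sumrB; apply: eq_bigr => j _.
by rewrite mxE /grid_incr mulrBr.
Qed.

Let gaussian_approx N : gaussian_family (P1 \x P2)%E (approx N)
  (fun k l => (row k.2 Q *m 1%:M *m (row l.2 Q)^T) ord0 ord0 *
      (N.+1%:R^-1 * \sum_(i < minn (grid_index N k.1) (grid_index N l.1))
        (expR (- (g * `|k.1|)) * expR (g * (i%:R / N.+1%:R))) *
        (expR (- (g * `|l.1|)) * expR (g * (i%:R / N.+1%:R)))) +
    expR (- (g * `|k.1|)) * expR (- (g * `|l.1|)) * (C k.2 l.2 / (2 * g))).
Proof.
have gI := gaussian_simple_integral (regular_brownian_motion HU HW) HU N
  (fun (k : R * 'I_m) i => expR (- (g * `|k.1|)) * expR (g * (i%:R / N.+1%:R)))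
  (fun k => row k.2 Q) (fun k => grid_index_le N k.1).
have gJ := gaussian_family_reindex gy (fun k : R * 'I_m => expR (- (g * `|k.1|))) snd.
exact: (gaussian_family_product_sum HU gI gJ).
Qed.

Lemma ou_solution_gaussian : gaussian_family (P1 \x P2)%E
  (fun k : R * 'I_m => ou_solution `|k.1| k.2)
  (fun k l : R * 'I_m => expR (- (g * `| `|k.1| - `|l.1| |)) / (2 * g) * C k.2 l.2).
Proof.
have g2 : 0 < 2 * g by rewrite mulr_gt0.
have [[QT _] QQ] := HQ.
apply: (gaussian_family_limit HU gaussian_approx).
- move=> k; apply: (measurable_fun_cvg (h := fun N => approx N k)) => [N|w _].
    exact: (gaussian_family_measurable (gaussian_approx N)).
  exact: cvg_approx.
- by move=> k; apply: aeW => w; exact: cvg_approx.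
move=> k l.
have rowQ : (row k.2 Q *m 1%:M *m (row l.2 Q)^T) ord0 ord0 = C k.2 l.2.
  rewrite mulmx1 -[in RHS]QQ !mxE; apply: eq_bigr => j _.
  by rewrite !mxE -{2}QT mxE.
have m0 : 0 <= Num.min `|k.1| `|l.1| by rewrite le_min !normr_ge0.
have minle N : (minn (grid_index N k.1) (grid_index N l.1))%:R / N.+1%:R
    <= Num.min `|k.1| `|l.1|.
  rewrite le_min; apply/andP; split.
    by apply: le_trans (grid_le N k.1); rewrite ler_pM2r ?invr_gt0// ler_nat geq_minl.
  by apply: le_trans (grid_le N l.1); rewrite ler_pM2r ?invr_gt0// ler_nat geq_minr.
have cS := cvg_exp_sum g2 m0 minle (@cvg_grid_index_min R k.1 l.1).
have -> : expR (- (g * `| `|k.1| - `|l.1| |)) / (2 * g) * C k.2 l.2 =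
    C k.2 l.2 * (expR (- (g * `|k.1|)) * expR (- (g * `|l.1|)) *
      ((expR (2 * g * Num.min `|k.1| `|l.1|) - 1) / (2 * g))) +
    expR (- (g * `|k.1|)) * expR (- (g * `|l.1|)) * (C k.2 l.2 / (2 * g)).
  by rewrite -ou_kernelE; field; rewrite gt_eqF.
apply: cvgD; last exact: cvg_cst.
rewrite rowQ; apply: cvgM; first exact: cvg_cst.
have -> : (fun N => N.+1%:R^-1 * \sum_(i < minn (grid_index N k.1) (grid_index N l.1))
        (expR (- (g * `|k.1|)) * expR (g * (i%:R / N.+1%:R))) *
        (expR (- (g * `|l.1|)) * expR (g * (i%:R / N.+1%:R)))) =
    (fun N => expR (- (g * `|k.1|)) * expR (- (g * `|l.1|)) * (N.+1%:R^-1 *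
      \sum_(i < minn (grid_index N k.1) (grid_index N l.1))
        expR (2 * g * (i%:R / N.+1%:R)))).
  apply/funext => N; rewrite mulrCA; congr (_ * _).
  rewrite big_distrr/=; apply: eq_bigr => i _.
  have -> : 2 * g * (i%:R / N.+1%:R) = g * (i%:R / N.+1%:R) + g * (i%:R / N.+1%:R).
    by rewrite -mulr2n -mulrA mulr_natl.
  by rewrite expRD mulrACA.
by apply: cvgM cS; exact: cvg_cst.
Qed.

Let lifted_noise (t : R) (i : 'I_m) (w : T1 * T2) := W t i w.1.

Let gaussian_joint := gaussian_family_product HU (rb_gaussian HW) gy.

Let lifted_noise_regular : regular_brownian (P1 \x P2)%E 1%:M lifted_noise.
Proof.
split => [|i w|i w]; last 2 first.
- exact: (rb_start HW).
- exact: (rb_continuous HW).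
apply: eq_gaussian_family
  (gaussian_family_reindex gaussian_joint (fun=> 1) (@inl (R * 'I_m) 'I_m)).
  by move=> k w; rewrite mul1r.
by move=> k l; rewrite !mul1r.
Qed.

Let ou_solution_start i w : ou_solution 0 i w = y i w.2.
Proof. exact: ou_path_start (noise_start w.1 i). Qed.

Lemma ou_solution_initial_law : centered_gaussian_vector (P1 \x P2)%E
  ((2 * g)^-1 *: C) (ou_solution 0).
Proof.
apply: gaussian_family_vector; apply: eq_gaussian_family
  (gaussian_family_reindex gaussian_joint (fun=> 1) (@inr (R * 'I_m) 'I_m)).
  by move=> i w; rewrite mul1r; exact/esym/ou_solution_start.
by move=> i j; rewrite !mul1r mxE mulrC.
Qed.

Lemma ou_solution_sde : ou_sde_solution ((- g)%:M : 'M[R]_m) C (P1 \x P2)%E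
  lifted_noise ou_solution.
Proof.
split.
- exact: (regular_brownian_motion HU lifted_noise_regular).
- move=> t i t0; have := gaussian_family_measurable ou_solution_gaussian (t, i).
  by rewrite /= (ger0_norm t0).
- apply: aeW => w i; apply: continuous_in_subspaceT => t /[!inE]/= /[!in_itv]/=.
  rewrite andbT => t0; apply: ou_path_continuous; first exact: noise_continuous.
  by apply: lt_le_trans t0; exact: ltrN10.
- pose swap (u : 'I_m + R * 'I_m) : R * 'I_m + 'I_m :=
    match u with inl i => inr i | inr k => inl k end.
  apply: (gaussian_independent HU (Y1 := ou_solution 0)
    (Y2 := fun k : R * 'I_m => lifted_noise k.1 k.2)).
    apply: eq_gaussian_family (gaussian_family_reindex gaussian_joint (fun=> 1) swap).
      by move=> [i|k] w; rewrite mul1r//; exact/esym/ou_solution_start.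
    by [].
  by move=> i k _ _; rewrite /= !mulr0.
- exists Q => //; apply: aeW => w t i t0.
  rewrite ou_solution_start [LHS](ou_path_equation _ _ (@noise_continuous w.1 i)
    (noise_start w.1 i) t0).
  congr (_ + _ + _); apply: eq_Rintegral => s _.
  rewrite (bigD1 i)//= mxE eqxx mulr1n big1 ?addr0// => j /negPf ji.
  by rewrite mxE eq_sym ji mulr0n mul0r.
Qed.

End sde_solution.

Lemma brownian_ou_process d (T : measurableType d) (P : probability T R)
    (m : nat) (C : 'M[R]_m) (b : R -> 'I_m -> T -> R) :
  C^T = C -> brownian_motion P C b ->
  stationary_ou_process ((- g)%:M : 'M[R]_m) C
    (- 2^-1 *: (invmx ((- g)%:M : 'M[R]_m) *m C)) P (lamperti g b).
Proof.
move=> CT Hb; have psdC : psd_mx C.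
  by split => // x; exact: brownian_covariance_ge0 Hb x.
have gZ := gaussian_lamperti g0 HU Hb.
split => //.
- move=> x x0; rewrite mul_mx_scalar -scalemxAl mxE nmulr_rlt0 ?oppr_lt0//.
  rewrite lt_neqAle mxE sumr_ge0 ?andbT => [|i _]; last by rewrite mxE -expr2 sqr_ge0.
  apply: contra_neq x0 => /esym/eqP.
  rewrite psumr_eq0 => [/allP h|i _]; last by rewrite mxE -expr2 sqr_ge0.
  apply/colP => i; have := h i (mem_index_enum i).
  by rewrite !mxE -expr2 sqrf_eq0 => /eqP.
- by move=> t i; exact: (gaussian_family_measurable gZ (t, i)).
- exact: lamperti_continuous Hb.
have [Q HQ] := psd_mx_sqrt psdC.
have [d1 [T1 [P1 [W HW]]]] := regular_standard_brownian_exists HU m.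
have gy : gaussian_family P (lamperti g b 0) (fun i j => C i j / (2 * g)).
  apply: eq_gaussian_family (gaussian_family_reindex gZ (fun=> 1) (fun i => (0, i))).
    by move=> i w; rewrite mul1r.
  by move=> i j; rewrite !mul1r /= subrr normr0 mulr0 oppr0 expR0 mul1r mulrC.
exists _, _, (P1 \x P)%E, (fun t i w => W t i w.1),
  (ou_solution Q W (lamperti g b 0)).
split.
- exact: ou_solution_sde.
- have -> : - 2^-1 *: (invmx ((- g)%:M : 'M[R]_m) *m C) = (2 * g)^-1 *: C.
    rewrite invmx_scalar mul_scalar_mx scalerA invrN mulrNN -invfM.
    by [].
  exact: ou_solution_initial_law.
move=> s n k kD U1 mU1.
have gS := ou_solution_gaussian HW HQ gy.
have gZs : gaussian_family P (fun k : R * 'I_m => lamperti g b (s + `|k.1|) k.2)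
    (fun k l => expR (- (g * `| `|k.1| - `|l.1| |)) / (2 * g) * C k.2 l.2).
  apply: eq_gaussian_family (gaussian_family_reindex gZ (fun=> 1)
    (fun k : R * 'I_m => (s + `|k.1|, k.2))).
    by move=> l w; rewrite mul1r.
  by move=> l l'; rewrite !mul1r /= opprD addrACA subrr add0r.
have := gaussian_family_same_law gZs gS (D := setT) (k := k) (fun=> I) mU1.
have kE j : `|(k j).1| = (k j).1 by rewrite ger0_norm//; exact: kD.
have tupleE T' (Z : R -> 'I_m -> T' -> R) :
    (fun w => [tuple Z `|(k j).1| (k j).2 w | j < n] : n.-tuple (measurableTypeR R)) =
    (fun w => [tuple Z (k j).1 (k j).2 w | j < n]).
  by apply/funext => w; apply: eq_mktuple => j; rewrite kE.
by rewrite (tupleE _ (fun t => lamperti g b (s + t))) tupleE.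
Qed.

End ornstein_uhlenbeck.

Unset Implicit Arguments.

Theorem theorem2p9 (R : realType)
    (dS : measure_display) (S : measurableType dS) (pi : probability S R)
    (p : R -> R.-pker S ~> S)
    (dO : measure_display) (Omega : measurableType dO) (PX : probability Omega R)
    (F : R -> set (set Omega)) (X : R -> Omega -> S)
    (HX : ergodic_markov_process PX F p pi X)
    (Ainv : L2 pi -> L2 pi) (HA : generator_assumption p Ainv)
    (d : measure_display) (T : measurableType d) (P : probability T R)
    (B W : L2 pi -> R -> T -> R)
    (HB : brownian_field Ainv P B) (HW : brownian_normalization Ainv P B W)
    (gamma : R) (hgamma : gamma < 0) :
  let Z := ou_field gamma B in
  [/\ forall f : L2 pi, one_perp f ->
        {ae P, forall w, forall t : R,
           Z f t w = expR (- (`|gamma| * t))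
             * Num.sqrt (cov_form Ainv f f / (2 * `|gamma|))
             * W f (expR (2 * `|gamma| * t)) w},
      stationary_random_field P Z &
      forall (m : nat) (f : 'I_m -> L2 pi), (forall i, one_perp (f i)) ->
        stationary_ou_process (gamma%:M : 'M[R]_m) (cov_mx Ainv f)
          (- 2^-1 *: (invmx (gamma%:M : 'M[R]_m) *m cov_mx Ainv f))
          P (fun t i => Z (f i) t)].
Proof.
have g0 : 0 < `|gamma| by rewrite normr_gt0 lt_eqF.
have gE : - `|gamma| = gamma by rewrite ltr0_norm// opprK.
have one_perp0 : one_perp (0 : L2 pi).
  rewrite /one_perp /= (_ : (\int[pi]_x _) = \int[pi]_x (0 : R))//.
  by rewrite Rintegral_cst// mul0r.
have HU : standard_brownian_motion P (W 0) := (HW 0 one_perp0).1.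
have covC f h : one_perp f -> one_perp h -> cov_form Ainv f h = cov_form Ainv h f.
  move=> f0 h0; apply/EFin_inj.
  have := bf_covariance HB f0 h0 ler01 ler01.
  have := bf_covariance HB h0 f0 ler01 ler01.
  rewrite minxx !mul1r => <- <-; congr (expectation P _); apply/funext => w.
  exact: mulrC.
move=> Z; split.
- move=> f f0; apply: filterS (HW f f0).2 => w BW t.
  rewrite /Z /ou_field BW ?expR_ge0// mulrA; congr (_ * _).
  have c0 : 0 <= (2 * `|gamma|)^-1 by rewrite invr_ge0 mulr_ge0.
  by rewrite (mulrC (cov_form _ _ _)) [in RHS]sqrtrM// sqrtrV ?mulr_ge0//; ring.
- split.
  + move=> f t f0; apply: measurable_funM => //.
    apply: (bm_measurable (bf_brownian HB (f := fun _ : 'I_1 => f) (fun=> f0)) ord0).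
    exact: expR_ge0.
  + move=> a f h t f0 h0; have := bf_linear HB a f0 h0 (expR_ge0 (2 * `|gamma| * t)).
    by apply: filterS => w BE; rewrite /Z /ou_field BE; ring.
  + move=> h n k k0 V mV.
    have Hb := bf_brownian HB (f := fun j => (k j).1) k0.
    have gZ := gaussian_lamperti g0 HU Hb.
    pose K j l := expR (- (`|gamma| * `|(k j).2 - (k l).2|)) / (2 * `|gamma|)
      * cov_form Ainv (k j).1 (k l).1.
    have gk s : gaussian_family P (fun j => Z (k j).1 ((k j).2 + s)) K.
      apply: eq_gaussian_family (gaussian_family_reindex gZ (fun=> 1)
        (fun j => ((k j).2 + s, j))).
        by move=> j w; rewrite mul1r.
      by move=> j l; rewrite !mul1r !mxE /= opprD addrACA subrr addr0.
    have g00 : gaussian_family P (fun j => Z (k j).1 (k j).2) K.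
      by apply: eq_gaussian_family (gk 0) => // j w; rewrite addr0.
    exact: (gaussian_family_same_law (gk h) g00 (D := setT) (k := id) (fun=> I) mV).
- move=> m f f0; rewrite -gE.
  apply: (brownian_ou_process g0 HU _ (bf_brownian HB f0)).
  by apply/matrixP => i j; rewrite !mxE covC.
Qed.
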